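(* Let $F$ be a field of characteristic $2$, let $\tau\in K_2(F)/2K_2(F)$ be a sum of two symbols, and let $(V,E)$ be the graph attached to $\tau$, with edges of type I and type II, as defined in the context. Then every two vertices of $(V,E)$ are connected by a path consisting of at most three edges, with at most one edge of type II and the others of type I; if three edges are necessary, including one of type II, then the path can be taken so that the edge of type II is in between the two edges of type I. Moreover, if one restricts to edges of type I only, every two vertices are connected by a path of length at most $4$.
   Context: $K_2(F)$ is the second Milnor $K$-group of $F$, and $\{a,b\}_2$ denotes the class of the symbol $\{a,b\}$ ($a,b\in F^\times$) in $K_2(F)/2K_2(F)$; such classes are called symbols in $K_2(F)/2K_2(F)$. The graph attached to $\tau$: the vertex set $V$ is the set of all ordered pairs $(S_1,S_2)$ of symbols in $K_2(F)/2K_2(F)$ with $S_1+S_2=\tau$. Two vertices $(S_1,S_2)$ and $(T_1,T_2)$ are connected by an edge if there exist $\alpha,\beta,\gamma,\delta\in F^\times$ and $x\in F$ with $x^2+\alpha\gamma\neq 0$ such that $S_1=\{\alpha,\beta\}_2$, $S_2=\{\gamma,\delta\}_2$, $T_1=\{\alpha,(x^2+\alpha\gamma)\beta\}_2$ and $T_2=\{\gamma,(x^2+\alpha\gamma)\delta\}_2$. If $x=0$ (resp. $x\neq 0$), the two vertices are said to be connected by an edge of type I (resp. of type II). *)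

(* Defs.v *)
From HB Require Import structures.
From mathcomp Require Import all_boot all_order all_algebra.
From mathcomp Require Import boolp.
From mathcomp.multinomials Require Import freeg.

Set Implicit Arguments.
Unset Strict Implicit.
Unset Printing Implicit Defensive.

Import GRing.Theory.
Local Open Scope ring_scope.
Local Open Scope quotient_scope.

Section Subgroups.
Variable V : zmodType.

Inductive generated (A : V -> Prop) : V -> Prop :=
| generated_in x : A x -> generated A x
| generated0 : generated A 0
| generatedB x y : generated A x -> generated A y -> generated A (x - y).

Definition span_of (A : V -> Prop) : {pred V} :=
  [pred x | `[< generated A x >]].

Lemma span_of_zmod_closed (A : V -> Prop) : zmod_closed (span_of A).
Proof.
split=> [|x y]; rewrite !inE; first by apply/asboolP; exact: generated0.
by move=> /asboolP Ax /asboolP Ay; apply/asboolP; exact: generatedB.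
Qed.

HB.instance Definition _ (A : V -> Prop) :=
  GRing.isZmodClosed.Build V (span_of A) (span_of_zmod_closed A).

Definition doubles : {pred V} := [pred x | `[< exists y, x = y *+ 2 >]].

Lemma doubles_zmod_closed : zmod_closed doubles.
Proof.
split=> [|x y]; rewrite !inE; first by apply/asboolP; exists 0; rewrite mul0rn.
move=> /asboolP[a ->] /asboolP[b ->]; apply/asboolP.
by exists (a - b); rewrite mulrnBl.
Qed.

HB.instance Definition _ :=
  GRing.isZmodClosed.Build V doubles doubles_zmod_closed.

End Subgroups.

Section MilnorK2.
Variable F : fieldType.

Definition units : Type := {x : F | x != 0}.

HB.instance Definition _ := Choice.on units.

Definition mkunit (x : F) (x_neq0 : x != 0) : units := exist _ x x_neq0.

Definition umul (a b : units) : units :=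
  mkunit (mulf_neq0 (valP a) (valP b)).

(* The first two families cut out the tensor square of the abelian group of
   units inside the free abelian group on pairs; the third one consists of the
   Steinberg relators {a, 1 - a}. *)
Inductive milnor_relator : {freeg (units * units)} -> Prop :=
| relator_mull a b c :
    milnor_relator (<< (umul a b, c) >> - << (a, c) >> - << (b, c) >>)
| relator_mulr a b c :
    milnor_relator (<< (a, umul b c) >> - << (a, b) >> - << (a, c) >>)
| relator_steinberg a b :
    val a + val b = 1 -> milnor_relator << (a, b) >>.

Definition K2 : Type := {ideal_quot (span_of milnor_relator)}.
HB.instance Definition _ := GRing.Zmodule.on K2.

Definition symbol (a b : units) : K2 :=
  \pi_{ideal_quot (span_of milnor_relator)} << (a, b) >>.

Definition K2mod2 : Type := {ideal_quot (@doubles K2)}.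
HB.instance Definition _ := GRing.Zmodule.on K2mod2.

Definition symbol2 (a b : units) : K2mod2 :=
  \pi_{ideal_quot (@doubles K2)} (symbol a b).

Definition is_symbol2 (S : K2mod2) : Prop :=
  exists a b : units, S = symbol2 a b.

End MilnorK2.

Section Graph.
Variables (F : fieldType) (tau : K2mod2 F).

Definition is_vertex (v : K2mod2 F * K2mod2 F) : Prop :=
  [/\ is_symbol2 v.1, is_symbol2 v.2 & v.1 + v.2 = tau].

Inductive edge_type := typeI | typeII.

Definition is_typeII (t : edge_type) : bool :=
  if t is typeII then true else false.

(* The same two vertices may be joined both by an edge of type I and by an edge
   of type II, through different presentations of their symbols. *)
Definition edge (t : edge_type) (v w : K2mod2 F * K2mod2 F) : Prop :=
  [/\ is_vertex v, is_vertex w &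
    exists (alpha beta gamma delta : units F) (x : F)
           (e_neq0 : x ^+ 2 + val alpha * val gamma != 0),
      let e := mkunit e_neq0 in
      [/\ is_typeII t = (x != 0),
          v = (symbol2 alpha beta, symbol2 gamma delta) &
          w = (symbol2 alpha (umul e beta), symbol2 gamma (umul e delta))]].

(* [path_in_graph v s w]: a path from v to w whose successive edges have the
   types listed in s, so that size s is the number of edges. *)
Inductive path_in_graph :
  K2mod2 F * K2mod2 F -> seq edge_type -> K2mod2 F * K2mod2 F -> Prop :=
| path_nil v : is_vertex v -> path_in_graph v [::] v
| path_cons t v u s w :
    edge t v u -> path_in_graph u s w -> path_in_graph v (t :: s) w.

End Graph.

(* Main.v *)
(* To a vertex ({a,b}, {c,d}) we attach the Albert form <a,b,ab,c,d,cd>. In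
   characteristic 2 its quadratic form is additive, and the differential form
   dlog a /\ dlog b + dlog c /\ dlog d is an invariant of tau. Evaluating this
   form on derivations D with D^2 = D shows that the Albert form is isotropic
   exactly when tau is a symbol; in that case every vertex is joined to (tau, 0)
   by an edge of type I.

   If the Albert form is anisotropic, an orthogonal basis split into two triples
   (a frame) determines a vertex depending only on the spans of the triples.
   Exchanging a vector of the first triple with one of the second is an edge of
   type I, and rotating the plane which they span is an edge of type I or II, so
   that the bounds on the paths between frames of one form are linear algebra in
   dimension 6. All vertices come from frames of one form: frames are stable
   under edges, and the forms of two vertices always have frames whose first
   symbols share a slot, which makes the corresponding vertices adjacent. *)

Require Import Defs.
From mathcomp Require Import all_boot all_order all_algebra ring zify.
From mathcomp Require Import boolp classical_sets.
From mathcomp.multinomials Require Import freeg.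

Set Implicit Arguments.
Unset Strict Implicit.
Unset Printing Implicit Defensive.

Import GRing.Theory.
Local Open Scope ring_scope.
Local Open Scope quotient_scope.

(** * Fields containing the squares, and derivations *)

(** Identities between symbols come only from bilinearity, the Steinberg relation and its
    consequences; the logarithmic form serves to produce the isotropic vectors to which they are
    applied. The obstacle is that da does not distinguish a slot a from a + z^2. If D^2 = D, then s
    = D a / a satisfies D s = s + s^2, so s is 0 or 1 as soon as D kills it, and this integrality
    removes the square. Intermediate fields k are carried along because isotropy over F^2(a') makes
    a' a quotient of two values of the Albert form; hence, when tau is not a symbol, the slots of
    any vertex generate one and the same field F^2(a, b, c, d). If it has degree at most 8 over F^2,
    a common slot comes from the count 6 + 6 - 8; if the degree is 16, from a toral derivation. The
    bounds 3 and 4 differ only in the middle of the path: two triples sharing two vectors are joined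
    by one rotation, or by two exchanges through a third triple. *)

Section SquareSubrings.
Variable F : fieldType.
Hypothesis F2 : 2%:R = 0 :> F.
Implicit Types (x y z t : F) (k : F -> Prop).

(* Such a set is a field, because [x^-1 = x * (x^-1)^2]. *)
Definition square_subring k : Prop :=
  [/\ forall x, k (x ^+ 2), forall x y, k x -> k y -> k (x + y)
    & forall x y, k x -> k y -> k (x * y)].

Definition adj k t : F -> Prop :=
  fun z => exists x y, [/\ k x, k y & z = x + y * t].

Definition squares : F -> Prop := fun z => exists x, z = x ^+ 2.

Lemma addFF x : x + x = 0.
Proof. by ring: F2. Qed.

Lemma oppF x : - x = x.
Proof. by apply/eqP; rewrite eq_sym -subr_eq0 opprK addFF. Qed.

Lemma addF_eq0 x y : x + y = 0 -> x = y.
Proof. by move=> h; rewrite -[x]addr0 -(addFF y) addrA h add0r. Qed.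

Lemma square_subring_squares : square_subring squares.
Proof.
split; first by move=> x; exists x.
- by move=> _ _ [x ->] [y ->]; exists (x + y); ring: F2.
- by move=> _ _ [x ->] [y ->]; exists (x * y); ring.
Qed.

Section FixedSubring.
Variable k : F -> Prop.
Hypothesis k_sub : square_subring k.

Lemma ssr_sqr x : k (x ^+ 2). Proof. by case: k_sub. Qed.
Lemma ssrD x y : k x -> k y -> k (x + y). Proof. by case: k_sub => _ + _; exact. Qed.
Lemma ssrM x y : k x -> k y -> k (x * y). Proof. by case: k_sub => _ _; exact. Qed.
Lemma ssr0 : k 0. Proof. have := ssr_sqr 0; by rewrite expr0n. Qed.
Lemma ssr1 : k 1. Proof. have := ssr_sqr 1; by rewrite expr1n. Qed.
Lemma ssrV x : k x -> k x^-1.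
Proof.
move=> kx; have [->|x0] := eqVneq x 0; first by rewrite invr0; exact: ssr0.
have -> : x^-1 = x * (x^-1) ^+ 2 by field.
by apply: ssrM => //; exact: ssr_sqr.
Qed.

Lemma adj_in t x : k x -> adj k t x.
Proof. by move=> kx; exists x, 0; split; rewrite ?mul0r ?addr0 //; exact: ssr0. Qed.

Lemma adj_gen t : adj k t t.
Proof. by exists 0, 1; split; [exact: ssr0|exact: ssr1|rewrite mul1r add0r]. Qed.

Lemma adj_square_subring t : square_subring (adj k t).
Proof.
split.
- by move=> x; apply: adj_in; exact: ssr_sqr.
- move=> _ _ [x [y [kx ky ->]]] [x' [y' [kx' ky' ->]]].
  by exists (x + x'), (y + y'); split; [exact: ssrD|exact: ssrD|ring].
- move=> _ _ [x [y [kx ky ->]]] [x' [y' [kx' ky' ->]]].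
  exists (x * x' + y * y' * t ^+ 2), (x * y' + y * x'); split; last by ring.
  + by apply: ssrD; [|apply: ssrM; [|exact: ssr_sqr]]; exact: ssrM.
  + by apply: ssrD; exact: ssrM.
Qed.

Lemma adj_inj t x y x' y' : ~ k t -> k x -> k y -> k x' -> k y' ->
  x + y * t = x' + y' * t -> x = x' /\ y = y'.
Proof.
move=> nkt kx ky kx' ky' e.
have yy' : y = y'.
  apply: contrapT => /eqP; rewrite -subr_eq0 => ny; apply: nkt.
  have -> : t = (x' - x) * (y - y')^-1.
    apply: (mulIf ny); rewrite divfK //.
    have -> : t * (y - y') = (x + y * t) - x - y' * t by ring.
    by rewrite e; ring.
  apply: ssrM; last apply: ssrV.
  - rewrite oppF; exact: ssrD.
  - rewrite oppF; exact: ssrD.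
by split=> //; move: e; rewrite yy' => /addIr.
Qed.

End FixedSubring.

End SquareSubrings.

Arguments squares {F} _.

Lemma char2_natr (F : fieldType) n : 2%:R = 0 :> F -> n%:R = (odd n)%:R :> F.
Proof.
by move=> F2; rewrite -{1}(odd_double_half n) natrD -muln2 natrM F2 mulr0 addr0.
Qed.

(* [ring] uses an equation [2 = 0] only on the coefficient 2 itself, whence the
   list of small coefficients. *)
Ltac ring2 F2 :=
  rewrite ?(oppF F2);
  ring: F2 (char2_natr 3 F2 : 3%:R = 1) (char2_natr 4 F2 : 4%:R = 0)
    (char2_natr 5 F2 : 5%:R = 1) (char2_natr 6 F2 : 6%:R = 0)
    (char2_natr 7 F2 : 7%:R = 1) (char2_natr 8 F2 : 8%:R = 0)
    (char2_natr 10 F2 : 10%:R = 0) (char2_natr 12 F2 : 12%:R = 0).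

Ltac ssr_closed :=
  by do ?[assumption | exact: ssr_sqr | exact: ssr0 | exact: ssr1
         | apply: ssrD => // | apply: ssrM => // | apply: ssrV => //].

Section Derivations.
Variable F : fieldType.
Hypothesis F2 : 2%:R = 0 :> F.
Implicit Types (x y z t : F) (k : F -> Prop) (D : F -> F).

Definition derivation D : Prop :=
  (forall x y, D (x + y) = D x + D y) /\
  (forall x y, D (x * y) = D x * y + x * D y).

Definition kills D k : Prop := forall x, k x -> D x = 0.

(** In characteristic 2 this makes D diagonalizable with eigenvalues 0 and 1. *)
Definition toral D : Prop := forall x, D (D x) = D x.

(** Adjoining any x outside a maximal K must produce t. The resulting equation t = a + b x can be
    solved for x. *)
Lemma exists_maximal_avoiding k t : square_subring k -> ~ k t ->
  exists K : F -> Prop, [/\ square_subring K, forall x, k x -> K x, ~ K t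
    & forall x, ~ K x -> adj K x t].
Proof.
move=> k_sub nkt.
(* Putting [k] inside [J] makes the empty chain harmless: its union stands for [k] itself. *)
pose J (X : set F) : F -> Prop := fun x => k x \/ X x.
pose P : set (set F) := fun X => square_subring (J X) /\ ~ J X t.
have [|A [[Asub nAt] Amax]] := @Zorn_bigcup F P.
  move=> C CP tot; split; last first.
    by move=> [//|[X CX Xt]]; case: (CP _ CX) => _; apply; right.
  have two x y : J (\bigcup_(X in C) X)%classic x -> J (\bigcup_(X in C) X)%classic y ->
      (k x /\ k y) \/ exists X, [/\ C X, J X x & J X y].
    move=> [kx|[X CX Xx]] [ky|[Y CY Yy]]; first by left.
    - by right; exists Y; split=> //; [left|right].
    - by right; exists X; split=> //; [right|left].
    - right; case: (tot X Y CX CY) => sub.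
      + by exists Y; split=> //; right => //; exact: sub.
      + by exists X; split=> //; right => //; exact: sub.
  have up X x : C X -> J X x -> J (\bigcup_(X in C) X)%classic x.
    by move=> CX [kx|Xx]; [left|right; exists X].
  split; first by move=> x; left; exact: ssr_sqr.
  - move=> x y Jx Jy; case: (two _ _ Jx Jy) => [[kx ky]|[X [CX JXx JXy]]].
      by left; exact: ssrD.
    by apply: (up X) => //; case: (CP _ CX) => h _; exact: ssrD.
  - move=> x y Jx Jy; case: (two _ _ Jx Jy) => [[kx ky]|[X [CX JXx JXy]]].
      by left; exact: ssrM.
    by apply: (up X) => //; case: (CP _ CX) => h _; exact: ssrM.
exists (J A); split=> //; first by move=> x; left.
move=> x nJx; apply: contrapT => nt.
apply: (Amax (adj (J A) x)).
  split; last by move=> /(_ x (adj_gen Asub x)) Ax; apply: nJx; right.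
  by move=> y Ay; apply: adj_in => //; right.
have e y : J (adj (J A) x) y <-> adj (J A) x y.
  by split; [move=> [ky|//]; apply: adj_in => //; left|right].
have [s1 s2 s3] := adj_square_subring Asub x.
split; last by move=> /e.
split; first by move=> y; apply/e.
- by move=> y z /e ? /e ?; apply/e; exact: s2.
- by move=> y z /e ? /e ?; apply/e; exact: s3.
Qed.

(* If [K] is maximal among the subrings containing [k] and not [t], then
   [F = K + K t], and [a + b t |-> b t] is the required derivation. *)
Lemma exists_toral k t : square_subring k -> ~ k t ->
  exists D, [/\ derivation D, toral D, kills D k & D t = t].
Proof.
move=> k_sub nkt; have [K [K_sub kK nKt Kmax]] := exists_maximal_avoiding k_sub nkt.
have F_adj x : exists ab : F * F, [/\ K ab.1, K ab.2 & x = ab.1 + ab.2 * t].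
  have [Kx|nKx] := pselect (K x).
    by exists (x, 0); split=> //=; [exact: ssr0|rewrite mul0r addr0].
  have [a [b [Ka Kb tE]]] := Kmax x nKx.
  have b0 : b != 0 by apply/eqP => b0; apply: nKt; rewrite tE b0 mul0r addr0.
  exists (a * b^-1, b^-1); split=> /=.
  - by apply: ssrM => //; exact: ssrV.
  - exact: ssrV.
  - rewrite tE mulrDr mulrA mulVf // mul1r mulrC.
    by rewrite addrA (addFF F2) add0r.
have [c cP] := choice F_adj.
have cE a b : K a -> K b -> c (a + b * t) = (a, b).
  move=> Ka Kb; case: (cP (a + b * t)); case: (c _) => a' b' /= Ka' Kb' e.
  by have [-> ->] := adj_inj F2 K_sub nKt Ka Kb Ka' Kb' e.
exists (fun x => (c x).2 * t).
have De x a b : K a -> K b -> x = a + b * t -> (c x).2 * t = b * t.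
  by move=> Ka Kb ->; rewrite cE.
have exD x : exists a b, [/\ K a, K b & x = a + b * t].
  by have [Ka Kb xE] := cP x; exists (c x).1, (c x).2.
split.
- split=> x y; have [a [b [Ka Kb xE]]] := exD x; have [a' [b' [Ka' Kb' yE]]] := exD y.
  + rewrite (De x a b) // (De y a' b') // (De (x + y) (a + a') (b + b')); first by ring.
    * by ssr_closed.
    * by ssr_closed.
    * by rewrite xE yE; ring.
  + rewrite (De x a b) // (De y a' b') //.
    rewrite (De (x * y) (a * a' + b * b' * t ^+ 2) (a * b' + b * a')).
    * by rewrite xE yE; ring2 F2.
    * by ssr_closed.
    * by ssr_closed.
    * by rewrite xE yE; ring.
- move=> x; have [_ Kb _] := cP x.
  by apply: (De _ 0) => //; [exact: ssr0|rewrite add0r].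
- move=> x kx; rewrite (De x x 0) ?mul0r ?addr0 //; [exact: kK|exact: ssr0].
- rewrite (De t 0 1) ?mul1r ?add0r //; [exact: ssr0|exact: ssr1].
Qed.

Section DerivationTheory.
Variable D : F -> F.
Hypothesis dD : derivation D.

Lemma derD x y : D (x + y) = D x + D y. Proof. by case: dD. Qed.
Lemma derM x y : D (x * y) = D x * y + x * D y. Proof. by case: dD. Qed.
Lemma der_sqr x : D (x ^+ 2) = 0. Proof. by rewrite expr2 derM; ring2 F2. Qed.
Lemma der0 : D 0 = 0. Proof. have := der_sqr 0; by rewrite expr0n. Qed.
Lemma der1 : D 1 = 0. Proof. have := der_sqr 1; by rewrite expr1n. Qed.
Lemma derV x : D x^-1 = D x * (x^-1) ^+ 2.
Proof.
have [->|x0] := eqVneq x 0; first by rewrite invr0 der0 mul0r.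
have {1}-> : x^-1 = x * (x^-1) ^+ 2 by field.
by rewrite derM der_sqr mulr0 addr0.
Qed.

Lemma kills_squares : kills D squares.
Proof. by move=> _ [x ->]; exact: der_sqr. Qed.

Lemma kills_adj k t : kills D k -> D t = 0 -> kills D (adj k t).
Proof. by move=> Dk Dt _ [x [y [kx ky ->]]]; rewrite derD derM Dt !Dk //; ring. Qed.

End DerivationTheory.

End Derivations.

(** * Symbols in K_2(F)/2 and the logarithmic form *)

Section Symbols.
Variable F : fieldType.
Hypothesis F2 : 2%:R = 0 :> F.
Implicit Types (a b c d x y : F).

(* Junk value: [unit_of 0 = 1], so that [sy 0 a = 0]. *)
Definition unit_of x : units F :=
  if (x != 0) =P true is ReflectT x_neq0 then mkunit x_neq0
  else mkunit (oner_neq0 F).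

Lemma val_unit_of x : x != 0 -> val (unit_of x) = x.
Proof. by rewrite /unit_of; case: eqP. Qed.

Lemma unit_ofK (u : units F) : unit_of (val u) = u.
Proof. by apply: val_inj; rewrite val_unit_of //; exact: (valP u). Qed.

Lemma unit_ofM x y : x != 0 -> y != 0 ->
  unit_of (x * y) = umul (unit_of x) (unit_of y).
Proof.
move=> x0 y0; apply: val_inj; rewrite val_unit_of ?mulf_neq0 //.
by rewrite /= !val_unit_of.
Qed.

Definition sy a b : K2mod2 F := symbol2 (unit_of a) (unit_of b).

Lemma symbol2_sy (u v : units F) : symbol2 u v = sy (val u) (val v).
Proof. by rewrite /sy !unit_ofK. Qed.

Lemma K2_relation (r : {freeg (units F * units F)}) :
  milnor_relator r -> \pi_({ideal_quot (span_of (@milnor_relator F))}) r = 0.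
Proof.
move=> rr; rewrite -(raddf0 (\pi_({ideal_quot (span_of (@milnor_relator F))}))).
apply/eqP; rewrite -Quotient.idealrBE subr0 inE; apply/asboolP.
by apply/asboolP; exact: generated_in.
Qed.

Lemma symbolMl (u v w : units F) :
  symbol (umul u v) w = symbol u w + symbol v w.
Proof.
have := K2_relation (relator_mull u v w).
by rewrite !raddfB /= => /eqP; rewrite -addrA -opprD subr_eq0 => /eqP.
Qed.

Lemma symbolMr (u v w : units F) :
  symbol u (umul v w) = symbol u v + symbol u w.
Proof.
have := K2_relation (relator_mulr u v w).
by rewrite !raddfB /= => /eqP; rewrite -addrA -opprD subr_eq0 => /eqP.
Qed.

Lemma symbol_steinberg (u v : units F) : val u + val v = 1 -> symbol u v = 0.
Proof. by move=> h; exact: (K2_relation (relator_steinberg h)). Qed.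

Lemma K2mod2_addxx (s : K2mod2 F) : s + s = 0.
Proof.
elim/quotW: s => s.
rewrite -raddfD /= -(raddf0 (\pi_({ideal_quot (@doubles (K2 F))}))).
apply/eqP; rewrite -Quotient.idealrBE subr0 inE; apply/asboolP.
by apply/asboolP; exists s; rewrite mulr2n.
Qed.

Lemma K2mod2_add_eq0 (s t : K2mod2 F) : s + t = 0 -> s = t.
Proof. by move=> h; rewrite -[s]addr0 -(K2mod2_addxx t) addrA h add0r. Qed.

Lemma syMl a b c : a != 0 -> b != 0 -> sy (a * b) c = sy a c + sy b c.
Proof. by move=> a0 b0; rewrite /sy unit_ofM // /symbol2 symbolMl raddfD. Qed.

Lemma syMr a b c : b != 0 -> c != 0 -> sy a (b * c) = sy a b + sy a c.
Proof. by move=> b0 c0; rewrite /sy unit_ofM // /symbol2 symbolMr raddfD. Qed.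

Lemma sy1r a : sy a 1 = 0.
Proof.
have := @syMr a 1 1 (oner_neq0 _) (oner_neq0 _).
by rewrite mulr1 => /eqP; rewrite -subr_eq0 opprD addrA subrr sub0r oppr_eq0 => /eqP.
Qed.

Lemma sy1l a : sy 1 a = 0.
Proof.
have := @syMl 1 1 a (oner_neq0 _) (oner_neq0 _).
by rewrite mulr1 => /eqP; rewrite -subr_eq0 opprD addrA subrr sub0r oppr_eq0 => /eqP.
Qed.

Lemma unit_of0 : unit_of 0 = unit_of 1.
Proof.
apply: val_inj; rewrite (val_unit_of (oner_neq0 _)) /unit_of.
by case: eqP => // h; case/negP: (h).
Qed.

Lemma sy0r a : sy a 0 = 0. Proof. by rewrite /sy unit_of0 -/(sy a 1) sy1r. Qed.
Lemma sy0l a : sy 0 a = 0. Proof. by rewrite /sy unit_of0 -/(sy 1 a) sy1l. Qed.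

Lemma sy_steinberg a b : a + b = 1 -> sy a b = 0.
Proof.
move=> ab; have [->|a0] := eqVneq a 0; first by rewrite sy0l.
have [->|b0] := eqVneq b 0; first by rewrite sy0r.
by rewrite /sy /symbol2 symbol_steinberg ?raddf0 // !val_unit_of.
Qed.

Lemma syVr a b : b != 0 -> sy a b^-1 = sy a b.
Proof.
move=> b0; apply: K2mod2_add_eq0.
by rewrite -syMr ?invr_eq0 // mulVf // sy1r.
Qed.

Lemma syVl a b : a != 0 -> sy a^-1 b = sy a b.
Proof.
move=> a0; apply: K2mod2_add_eq0.
by rewrite -syMl ?invr_eq0 // mulVf // sy1l.
Qed.

(* [{a, 1 - a} = 0 = {a^-1, 1 - a^-1}], and [1 - a] is [- a (1 - a^-1)]. *)
Lemma sy_aa a : sy a a = 0.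
Proof.
have [->|a0] := eqVneq a 0; first exact: sy0l.
have [a1|a1] := eqVneq (1 + a) 0.
  by rewrite -(addF_eq0 F2 a1) sy1l.
have e : a * (1 + a^-1) = 1 + a by rewrite mulrDr mulfV // mulr1 addrC.
have a1' : 1 + a^-1 != 0 by apply: contraNneq a1 => h; rewrite -e h mulr0.
have h1 : sy a (1 + a) = 0 by apply: sy_steinberg; ring2 F2.
have h2 : sy a (1 + a^-1) = 0.
  by rewrite -syVl //; apply: sy_steinberg; ring2 F2.
by move: h1; rewrite -e syMr // h2 addr0.
Qed.

Lemma syC a b : sy a b = sy b a.
Proof.
have [->|a0] := eqVneq a 0; first by rewrite sy0l sy0r.
have [->|b0] := eqVneq b 0; first by rewrite sy0l sy0r.
have := sy_aa (a * b); rewrite syMl // !syMr // !sy_aa add0r addr0.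
exact: K2mod2_add_eq0.
Qed.

Lemma sy_sqrr a x : sy a (x ^+ 2) = 0.
Proof.
have [->|x0] := eqVneq x 0; first by rewrite expr0n sy0r.
by rewrite expr2 syMr // K2mod2_addxx.
Qed.

Lemma sy_sqrMr a x b : x != 0 -> sy a (x ^+ 2 * b) = sy a b.
Proof.
move=> x0; have [->|b0] := eqVneq b 0; first by rewrite mulr0.
by rewrite syMr ?sqrf_eq0 ?expf_neq0 // sy_sqrr add0r.
Qed.

Lemma sy_sqrMl x a b : x != 0 -> sy (x ^+ 2 * a) b = sy a b.
Proof. by move=> x0; rewrite syC sy_sqrMr // syC. Qed.

Lemma sy_sqrl x a : sy (x ^+ 2) a = 0.
Proof. by rewrite syC sy_sqrr. Qed.

(** Expand the Steinberg relation for a / (a + b) and b / (a + b), whose sum is 1. *)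
Lemma sy_addM a b : a != 0 -> b != 0 -> a + b != 0 -> sy (a + b) (a * b) = sy a b.
Proof.
move=> a0 b0 ab0.
have : sy (a / (a + b)) (b / (a + b)) = 0.
  by apply: sy_steinberg; field.
have v0 : (a + b)^-1 != 0 by rewrite invr_eq0.
rewrite syMl // !syMr // !(syVl _ ab0) !(syVr _ ab0) sy_aa addr0.
rewrite (syC a (a + b)) -!addrA => h; apply/esym/K2mod2_add_eq0.
by rewrite -h.
Qed.

(** By [sy_addM] for x^2 and a y^2, the symbol of their sum n and their product is {x^2, a y^2} = 0;
    modulo squares the product is a. *)
Lemma sy_norm a x y : sy a (x ^+ 2 + a * y ^+ 2) = 0.
Proof.
have [->|a0] := eqVneq a 0; first by rewrite sy0l.
have [->|x0] := eqVneq x 0.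
  rewrite expr0n add0r; have [->|y0] := eqVneq y 0; first by rewrite expr0n mulr0 sy0r.
  by rewrite mulrC sy_sqrMr // sy_aa.
have [->|y0] := eqVneq y 0; first by rewrite expr0n mulr0 addr0 sy_sqrr.
have [->|n0] := eqVneq (x ^+ 2 + a * y ^+ 2) 0; first by rewrite sy0r.
have x20 : x ^+ 2 != 0 by rewrite expf_neq0.
have y20 : y ^+ 2 != 0 by rewrite expf_neq0.
have := sy_addM x20 (mulf_neq0 a0 y20) n0.
set n := x ^+ 2 + _; rewrite sy_sqrl sy_sqrMr // => <-.
by rewrite syC [a * _]mulrC sy_sqrMr.
Qed.

End Symbols.

Section LogForm.
Variable F : fieldType.
Hypothesis F2 : 2%:R = 0 :> F.

Definition dlog (D : F -> F) (x : F) : F := D x / x.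

(** The 2-form dlog a /\ dlog b evaluated on the pair (D, D'). *)
Definition wedge (D D' : F -> F) (a b : F) : F :=
  dlog D a * dlog D' b + dlog D' a * dlog D b.

Lemma dlogM D x y : derivation D -> x != 0 -> y != 0 ->
  dlog D (x * y) = dlog D x + dlog D y.
Proof. by move=> dD x0 y0; rewrite /dlog (derM dD); field; rewrite x0 y0. Qed.

Variables D D' : F -> F.
Hypotheses (dD : derivation D) (dD' : derivation D').

Lemma wedgeMl a b c : a != 0 -> b != 0 ->
  wedge D D' (a * b) c = wedge D D' a c + wedge D D' b c.
Proof. by move=> a0 b0; rewrite /wedge !(dlogM dD, dlogM dD') //; ring. Qed.

Lemma wedgeMr a b c : b != 0 -> c != 0 ->
  wedge D D' a (b * c) = wedge D D' a b + wedge D D' a c.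
Proof. by move=> a0 b0; rewrite /wedge !(dlogM dD, dlogM dD') //; ring. Qed.

Lemma wedge_steinberg a b : a + b = 1 -> a != 0 -> b != 0 -> wedge D D' a b = 0.
Proof.
move=> ab a0 b0; have -> : b = 1 + a by rewrite -ab addrAC addFF // add0r.
rewrite /wedge /dlog (derD dD) (derD dD') (der1 F2 dD) (der1 F2 dD') !add0r.
by ring2 F2.
Qed.

Lemma exists_freeg_lift (K : choiceType) (w : K -> F) :
  exists L : {freeg K} -> F,
    (forall x y, L (x - y) = L x - L y) /\ (forall u, L << u >> = w u).
Proof.
exists (fglift (w : K -> zmodule F)); split; first exact: (@lift_is_additive int K (zmodule F) w).
by move=> u; rewrite liftU scale1r.
Qed.

Section Lift.
Variable L : {freeg (units F * units F)} -> F.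
Hypothesis LB : forall x y, L (x - y) = L x - L y.
Hypothesis LU : forall u, L << u >> = wedge D D' (val u.1) (val u.2).

Lemma lift_UBB u v t : L (<< u >> - << v >> - << t >>) =
  wedge D D' (val u.1) (val u.2) - wedge D D' (val v.1) (val v.2)
  - wedge D D' (val t.1) (val t.2).
Proof. by rewrite !LB !LU. Qed.

Lemma lift_relator x : milnor_relator x -> L x = 0.
Proof.
have n0 (u : units F) : val u != 0 by exact: (valP u).
case=> [u v t|u v t|u v uv].
- refine (eq_trans (lift_UBB _ _ _) _).
  by rewrite [X in X - _ - _]wedgeMl ?n0 // [X in X - _]addrAC subrr add0r subrr.
- refine (eq_trans (lift_UBB _ _ _) _).
  by rewrite [X in X - _ - _]wedgeMr ?n0 // [X in X - _]addrAC subrr add0r subrr.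
- refine (eq_trans (LU _) _); exact: wedge_steinberg.
Qed.

Lemma lift_span x : x \in span_of (@milnor_relator F) -> L x = 0.
Proof.
have L0 : L 0 = 0 by have := LB 0 0; rewrite !subrr.
rewrite inE => /asboolP/asboolP; elim=> [y|//|y z _ hy _ hz].
- exact: lift_relator.
- by rewrite LB hy hz subrr.
Qed.

End Lift.

(* The logarithmic form [dlog : K_2(F)/2 -> Omega^2_F], evaluated on [D] and [D']. *)
Lemma exists_log_form : exists om : K2mod2 F -> F,
  (forall s t, om (s + t) = om s + om t) /\
  (forall a b, om (sy a b) = wedge D D' (val (unit_of a)) (val (unit_of b))).
Proof.
have [L [LB LU]] := @exists_freeg_lift (units F * units F)%type
  (fun u => wedge D D' (val u.1) (val u.2)).
(* The lift passes to both quotients: relators are killed by [lift_span], and doubles because 2 = 0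
   in F. *)
pose om1 (s : K2 F) : F := L (repr s).
have om1E x : om1 (\pi_{ideal_quot (span_of (@milnor_relator F))} x) = L x.
  apply/eqP; rewrite -subr_eq0 -LB (lift_span LB LU) //.
  by rewrite Quotient.idealrBE reprK.
have om1B s t : om1 (s - t) = om1 s - om1 t.
  by elim/quotW: s => s; elim/quotW: t => t; rewrite -raddfB /= !om1E; exact: LB.
have om10 : om1 0 = 0 by rewrite -(subrr 0) om1B subrr.
have om1D s t : om1 (s + t) = om1 s + om1 t.
  by rewrite -{1}[t]opprK om1B -(sub0r t) om1B om10 sub0r opprK.
pose om (s : K2mod2 F) : F := om1 (repr s).
have omE x : om (\pi_{ideal_quot (@doubles (K2 F))} x) = om1 x.
  apply/eqP; rewrite -subr_eq0 -om1B.
  have : repr (\pi_{ideal_quot (@doubles (K2 F))} x) - x \in @doubles (K2 F).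
    by rewrite Quotient.idealrBE reprK.
  by rewrite inE => /asboolP/asboolP[y ->]; rewrite mulr2n om1D addFF.
exists om; split.
- move=> s t; elim/quotW: s => s; elim/quotW: t => t.
  by rewrite -raddfD /= !omE om1D.
- by move=> a b; rewrite /sy /symbol2 omE /symbol om1E LU.
Qed.

End LogForm.

(** * Isotropy of Albert forms *)

Section Towers.
Variable F : fieldType.
Hypothesis F2 : 2%:R = 0 :> F.
Implicit Types (a b c x y t : F) (k : F -> Prop) (D : F -> F) (s : seq F).

(* [free k s]: the elements of [s] are 2-independent over the field [k]. *)
Fixpoint free k s : Prop :=
  if s is t :: s' then ~ k t /\ free (adj k t) s' else True.

Lemma adjC k a b : square_subring k -> adj (adj k a) b = adj (adj k b) a.
Proof.
have sub c d z : adj (adj k c) d z -> adj (adj k d) c z.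
  move=> [_ [_ [[x [y [kx ky ->]]] [x' [y' [kx' ky' ->]]] ->]]].
  exists (x + x' * d), (y + y' * d); split; last by ring.
  - by exists x, x'.
  - by exists y, y'.
by move=> _; apply/funext => z; apply/propext; split; exact: sub.
Qed.

Lemma adj_exchange k b t : square_subring k -> ~ k b -> adj k t b -> adj k b t.
Proof.
move=> k_sub nkb [x [y [kx ky bE]]].
have [y0|y0] := eqVneq y 0; first by case: nkb; rewrite bE y0 mul0r addr0.
exists (y^-1 * x), y^-1; split; try by ssr_closed.
rewrite bE mulrDr (mulrA _ y) mulVf // mul1r addrA addFF // add0r //.
Qed.

Lemma free_swap k a b s : square_subring k -> free k [:: a, b & s] -> free k [:: b, a & s].
Proof.
move=> k_sub /= [nka [nkab fs]]; split; first by move=> /(adj_in k_sub a).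
split; last by rewrite adjC.
by move=> /(adj_exchange k_sub nka).
Qed.

(** Each element of s is moved into the ground field in turn, so that the derivation finally
    obtained from [exists_toral] kills all of them. *)
Lemma free_dual k a s : square_subring k -> free k (a :: s) ->
  exists D, [/\ derivation D, toral D, kills D k, D a = a & {in s, forall x, D x = 0}].
Proof.
elim: s k => [|b s IH] k k_sub fas.
  by have [D [? ? ? ?]] := exists_toral F2 k_sub fas.1; exists D.
have [nkb fas'] := free_swap k_sub fas.
have [D [dD tD Dk Da Ds]] := IH _ (adj_square_subring k_sub b) fas'.
exists D; split=> // [x kx|x]; first by apply: Dk; exact: adj_in.
by rewrite inE => /orP[/eqP ->|/Ds //]; apply: Dk; exact: adj_gen.
Qed.

Lemma derivation_add D D' : derivation D -> derivation D' ->
  derivation (fun x => D x + D' x).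
Proof.
move=> dD dD'; split=> x y.
- by rewrite (derD dD) (derD dD'); ring.
- by rewrite (derM dD) (derM dD'); ring.
Qed.

Lemma derivation_scale a D : derivation D -> derivation (fun x => a * D x).
Proof.
move=> dD; split=> x y.
- by rewrite (derD dD); ring.
- by rewrite (derM dD); ring.
Qed.

Lemma wedgeC D D' a b : wedge D D' a b = wedge D D' b a.
Proof. by rewrite /wedge; ring. Qed.

(** The Plücker relation: a decomposable 2-form has square zero. *)
Lemma wedge_pfaffian D1 D2 D3 D4 a b :
  wedge D1 D2 a b * wedge D3 D4 a b + wedge D1 D3 a b * wedge D2 D4 a b
  + wedge D1 D4 a b * wedge D2 D3 a b = 0.
Proof. by rewrite /wedge; ring2 F2. Qed.

(* Isotropy over [k] of the Albert form <a, b, ab, c, d, cd> of {a,b} + {c,d};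
   its coefficients may be taken in a field [k] containing the squares. *)
Definition albert_isotropic k (a b c d : F) : Prop :=
  exists c1 c2 c3 c4 c5 c6 : F,
    [/\ [/\ k c1, k c2 & k c3], [/\ k c4, k c5 & k c6],
      c1 * a + c2 * b + c3 * (a * b) + c4 * c + c5 * d + c6 * (c * d) = 0
    & ~~ [&& c1 == 0, c2 == 0, c3 == 0, c4 == 0, c5 == 0 & c6 == 0]].

Definition pure_isotropic k (a b : F) : Prop :=
  exists c1 c2 c3 : F,
    [/\ [/\ k c1, k c2 & k c3], c1 * a + c2 * b + c3 * (a * b) = 0
    & ~~ [&& c1 == 0, c2 == 0 & c3 == 0]].

Lemma albert_isotropic_swap k a b c d :
  albert_isotropic k a b c d -> albert_isotropic k a b d c.
Proof.
move=> [c1 [c2 [c3 [c4 [c5 [c6 [k123 [k4 k5 k6] e nz]]]]]]].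
exists c1, c2, c3, c5, c4, c6; split=> //; first by rewrite -[RHS]e; ring.
by apply: contra nz => /and5P[-> -> -> -> /andP[-> ->]].
Qed.

Lemma albert_isotropic_pure_left k a b c d : square_subring k ->
  pure_isotropic k a b -> albert_isotropic k a b c d.
Proof.
move=> k_sub [c1 [c2 [c3 [[k1 k2 k3] e nz]]]].
exists c1, c2, c3, 0, 0, 0; split=> //; try by split; ssr_closed.
- by rewrite !mul0r !addr0.
- by apply: contra nz => /and5P[-> -> -> _ _].
Qed.

Lemma free_pair k a b : square_subring k -> a != 0 -> b != 0 ->
  ~ pure_isotropic k a b -> free k [:: a; b].
Proof.
move=> k_sub a0 b0 niso.
have nka : ~ k a.
  move=> ka; apply: niso; exists 0, a, 1; split.
  - by split; ssr_closed.
  - by ring2 F2.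
  - by rewrite oner_eq0 !andbF.
split=> //; split=> // - [x [y [kx ky bE]]]; apply: niso.
(* This is the relation b + y a + x = 0 multiplied by a b. *)
exists (b ^+ 2), (y * a ^+ 2), x; split.
- by split; ssr_closed.
- by rewrite !bE; ring2 F2.
- by rewrite sqrf_eq0 (negbTE b0).
Qed.

(* Over [k(a, b)] the vectors c, d, cd are dependent modulo a, b, ab. *)
Lemma albert_isotropic_small k a b c d : square_subring k ->
  adj (adj k a) b c -> adj (adj k a) b d -> albert_isotropic k a b c d.
Proof.
move=> k_sub [_ [_ [[c0 [c1 [kc0 kc1 ->]]] [c2 [c3 [kc2 kc3 ->]]] cE]]].
move=> [_ [_ [[d0 [d1 [kd0 kd1 ->]]] [d2 [d3 [kd2 kd3 ->]]] dE]]].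
have [c00|c00] := eqVneq c0 0.
  exists c1, c2, c3, 1, 0, 0; split; try by split; ssr_closed.
  - by rewrite cE c00; ring2 F2.
  - by rewrite oner_eq0 !andbF.
(* In d0 c + c0 d the constant terms cancel. *)
exists (d0 * c1 + c0 * d1), (d0 * c2 + c0 * d2), (d0 * c3 + c0 * d3), d0, c0, 0.
split; try by split; ssr_closed.
- by rewrite cE dE; ring2 F2.
- by rewrite (negbTE c00) !andbF.
Qed.

End Towers.

(** * Toral derivations in the kernel of the logarithmic form *)

Section DependentTower.
Variable F : fieldType.
Hypothesis F2 : 2%:R = 0 :> F.
Variable k : F -> Prop.
Hypothesis k_sub : square_subring k.
Variables a b c d : F.
Hypothesis abc_free : free k [:: a; b; c].

Lemma free3_nz : [/\ a != 0, b != 0 & c != 0].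
Proof.
have [nka [nkb [nkc _]]] := abc_free; split; apply/eqP => e0.
- by apply: nka; rewrite e0; ssr_closed.
- by apply: nkb; rewrite e0; exact: ssr0 (adj_square_subring k_sub a).
- by apply: nkc; rewrite e0; exact: ssr0 (adj_square_subring (adj_square_subring k_sub a) b).
Qed.

Lemma free2_coef x0 x1 x2 x3 : k x0 -> k x1 -> k x2 -> k x3 ->
  x0 + x1 * a + (x2 + x3 * a) * b = 0 -> [/\ x0 = 0, x1 = 0, x2 = 0 & x3 = 0].
Proof.
move=> k0 k1 k2 k3 e; have [nka [nkb _]] := abc_free.
have z0 : k 0 by exact: ssr0.
have A x y : k x -> k y -> adj k a (x + y * a) by move=> *; exists x, y.
have e0 : x0 + x1 * a + (x2 + x3 * a) * b = (0 + 0 * a) + (0 + 0 * a) * b.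
  by rewrite e; ring.
have [e1 e2] := adj_inj F2 (adj_square_subring k_sub a) nkb (A _ _ k0 k1)
   (A _ _ k2 k3) (A _ _ z0 z0) (A _ _ z0 z0) e0.
have [-> ->] := adj_inj F2 k_sub nka k0 k1 z0 z0 e1.
by have [-> ->] := adj_inj F2 k_sub nka k2 k3 z0 z0 e2.
Qed.

(** The vanishing minors say that the rows u and v have rank at most one, so both are multiples of
    one row m over the field k; (x, y) is kept nonzero even when both rows vanish. *)
Lemma common_direction u1 u2 u3 v1 v2 v3 :
  k u1 -> k u2 -> k u3 -> k v1 -> k v2 -> k v3 ->
  [/\ u1 * v2 = v1 * u2, u1 * v3 = v1 * u3 & u2 * v3 = v2 * u3] ->
  exists x y m1 m2 m3, [/\ [/\ k x, k y, (x != 0) || (y != 0) & [/\ k m1, k m2 & k m3]],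
    [/\ u1 = x * m1, u2 = x * m2 & u3 = x * m3]
    & [/\ v1 = y * m1, v2 = y * m2 & v3 = y * m3]].
Proof.
move=> k1 k2 k3 l1 l2 l3 [e12 e13 e23].
have gen x y : k x -> k y -> (x != 0) || (y != 0) ->
    x * v1 = y * u1 -> x * v2 = y * u2 -> x * v3 = y * u3 ->
  exists x y m1 m2 m3, [/\ [/\ k x, k y, (x != 0) || (y != 0) & [/\ k m1, k m2 & k m3]],
    [/\ u1 = x * m1, u2 = x * m2 & u3 = x * m3]
    & [/\ v1 = y * m1, v2 = y * m2 & v3 = y * m3]].
  move=> kx ky; have [-> /= y0|x0 _] := eqVneq x 0.
    have z u v : 0 * v = y * u -> u = 0.
      by rewrite mul0r => /esym/eqP; rewrite mulf_eq0 (negbTE y0) => /eqP.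
    move=> /z -> /z -> /z ->; exists 0, y, (y^-1 * v1), (y^-1 * v2), (y^-1 * v3).
    split; first by split; rewrite ?y0 ?orbT //; try split; ssr_closed.
      by rewrite !mul0r.
    by rewrite !mulVKf.
  have q u v : x * v = y * u -> v = y * (x^-1 * u).
    by move=> e; apply: (mulfI x0); rewrite e mulrCA mulVKf.
  move=> /q e1 /q e2 /q e3; exists x, y, (x^-1 * u1), (x^-1 * u2), (x^-1 * u3).
  split=> //; first by split; rewrite ?x0 //; try split; ssr_closed.
  by rewrite !mulVKf.
have [n1|n1] := boolP ((u1 != 0) || (v1 != 0)); first by apply: (gen u1 v1) => //; ring.
have [n2|n2] := boolP ((u2 != 0) || (v2 != 0)).
  by apply: (gen u2 v2) => //; [rewrite mulrC -e12 mulrC|ring].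
have [n3|n3] := boolP ((u3 != 0) || (v3 != 0)).
  by apply: (gen u3 v3) => //; [rewrite mulrC -e13 mulrC|rewrite mulrC -e23 mulrC|ring].
move: n1 n2 n3; rewrite !negb_or !negbK => /andP[/eqP-> /eqP->] /andP[/eqP-> /eqP->].
move=> /andP[/eqP-> /eqP->]; exists 1, 0, 0, 0, 0; split; rewrite ?mulr0 //.
by split; rewrite ?oner_neq0 //; try split; ssr_closed.
Qed.

Variables u0 u1 u2 u3 v0 v1 v2 v3 : F.
Hypotheses (ku0 : k u0) (ku1 : k u1) (ku2 : k u2) (ku3 : k u3).
Hypotheses (kv0 : k v0) (kv1 : k v1) (kv2 : k v2) (kv3 : k v3).
Hypothesis dE : d = u0 + u1 * a + (u2 + u3 * a) * b
                    + (v0 + v1 * a + (v2 + v3 * a) * b) * c.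
Hypothesis d0 : d != 0.
Variable D : F -> F.
Hypotheses (dD : derivation D) (tD : toral D) (Dk : kills D k) (Dc : D c = c).
(** The bracket is b times the partial derivative of d in b (in [Db], a times the one in a). The
    equation says that dlog a /\ dlog b + dlog c /\ dlog d vanishes on D and the derivation dual to
    b. *)
Hypothesis Da : d * D a = (u2 * b + u3 * a * b + (v2 * b + v3 * a * b) * c) * a.
Hypothesis Db : d * D b = (u1 * a + u3 * a * b + (v1 * a + v3 * a * b) * c) * b.

Let s := D a / a.
Let t := D b / b.

Let DaE : D a = s * a.
Proof. by rewrite /s divfK //; case: free3_nz. Qed.
Let DbE : D b = t * b.
Proof. by rewrite /t divfK //; case: free3_nz. Qed.

Let sd : s * d = u2 * b + u3 * a * b + (v2 * b + v3 * a * b) * c.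
Proof.
have [a0 _ _] := free3_nz; apply: (mulIf a0).
by rewrite -Da DaE; ring.
Qed.

Let td : t * d = u1 * a + u3 * a * b + (v1 * a + v3 * a * b) * c.
Proof.
have [_ b0 _] := free3_nz; apply: (mulIf b0).
by rewrite -Db DbE; ring.
Qed.

Let Ds : D s = s + s ^+ 2.
Proof.
have [a0 _ _] := free3_nz; apply: (mulIf a0).
have := tD a; rewrite DaE (derM dD) DaE => h.
by rewrite mulrDl -{1}h; ring2 F2.
Qed.

Let Dt : D t = t + t ^+ 2.
Proof.
have [_ b0 _] := free3_nz; apply: (mulIf b0).
have := tD b; rewrite DbE (derM dD) DbE => h.
by rewrite mulrDl -{1}h; ring2 F2.
Qed.

Let D_lin x0 x1 x2 x3 : k x0 -> k x1 -> k x2 -> k x3 ->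
  D (x0 + x1 * a + (x2 + x3 * a) * b)
  = s * (x1 * a + x3 * a * b) + t * (x2 * b + x3 * a * b).
Proof.
move=> k0 k1 k2 k3.
rewrite !((derD dD), (derM dD)) (Dk k0) (Dk k1) (Dk k2) (Dk k3) DaE DbE.
by ring.
Qed.

Let Dd : D d = (v0 + v1 * a + (v2 + v3 * a) * b) * c.
Proof.
rewrite {1}dE (derD dD) (derM dD) Dc !D_lin //.
apply: (mulIf d0).
set V := v0 + _ + _.
have -> : (s * (u1 * a + u3 * a * b) + t * (u2 * b + u3 * a * b) +
  ((s * (v1 * a + v3 * a * b) + t * (v2 * b + v3 * a * b)) * c + V * c)) * d
  = s * d * (u1 * a + u3 * a * b + (v1 * a + v3 * a * b) * c)
   + t * d * (u2 * b + u3 * a * b + (v2 * b + v3 * a * b) * c) + V * c * d by ring.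
(* The first two terms are both (s d)(t d), so they cancel. *)
by rewrite sd td; ring2 F2.
Qed.

Let DV : s * (v1 * a + v3 * a * b) + t * (v2 * b + v3 * a * b) = 0.
Proof.
have [_ _ c0] := free3_nz.
(* Write D d = V c. As D c = c, D (V c) = (D V) c + V c, and D^2 = D forces D V = 0. *)
have := tD d; rewrite Dd (derM dD) Dc D_lin // => h.
apply: (mulIf c0); rewrite mul0r; apply: (@addIr _ ((v0 + v1 * a + (v2 + v3 * a) * b) * c)).
by rewrite h add0r.
Qed.

(* Multiplying [DV] by [d] gives an identity in k(a, b), which is read on the
   basis 1, a, b, ab. *)
Let minors : [/\ u1 * v2 = v1 * u2, u1 * v3 = v1 * u3 & u2 * v3 = v2 * u3].
Proof.
have [a0 b0 c0] := free3_nz.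
have z0 : k 0 by exact: ssr0.
have E : (u1 * v2 + v1 * u2) + (u3 * v1 + u1 * v3) * a + ((u2 * v3 + u3 * v2) + 0 * a) * b = 0.
  have := congr1 (fun x => x * d) DV.
  rewrite mul0r mulrDl mulrAC sd [t * _ * d]mulrAC td => h.
  by apply: (mulIf (mulf_neq0 a0 b0)); rewrite !mul0r -[RHS]h; ring2 F2.
have [||||E0 E1 E2 _] := free2_coef _ _ _ _ E; try by ssr_closed.
split; apply: (addF_eq0 F2) => //.
- by rewrite -[RHS]E1; ring.
- by rewrite -[RHS]E2; ring.
Qed.

(* A derivation acts on [a], [b], [c] as if it were dual to [c] for the form
   dlog a /\ dlog b + dlog c /\ dlog d, of which it lies in the kernel. *)
Lemma albert_isotropic_kernel : albert_isotropic k a b c d.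
Proof.
have [a0 b0 c0] := free3_nz.
have [x [y [m1 [m2 [m3 [[kx ky xy0 [km1 km2 km3]] [U1 U2 U3] [V1 V2 V3]]]]]]] :=
  common_direction ku1 ku2 ku3 kv1 kv2 kv3 minors.
pose Ma := m1 * a + m3 * a * b; pose Mb := m2 * b + m3 * a * b.
pose M := m1 * a + m2 * b + m3 * a * b; pose N := x + y * c.
have N0 : N != 0.
  apply/eqP => N0; have [_ [_ [nkc _]]] := abc_free; apply: nkc.
  have [y0|y0] := eqVneq y 0; first by move: xy0 N0; rewrite /N y0 eqxx orbF mul0r addr0 => /eqP.
  have -> : c = y^-1 * x by apply: (mulfI y0); rewrite mulVKf // -[RHS](addr0) -N0 /N; ring2 F2.
  by do 2![apply: adj_in; first by repeat exact: adj_square_subring]; ssr_closed.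
have dE' : d = u0 + v0 * c + N * M by rewrite dE U1 U2 U3 V1 V2 V3 /N /M; ring.
have sd' : s * d = N * Mb by rewrite sd U2 U3 V2 V3 /N /Mb; ring.
have td' : t * d = N * Ma by rewrite td U1 U3 V1 V3 /N /Ma; ring.
have Dd' : D d = (v0 + y * M) * c by rewrite Dd V1 V2 V3 /M; ring.
have DN : D N = y * c by rewrite /N (derD dD) (derM dD) Dc (Dk kx) (Dk ky); ring.
have DMa : D Ma = s * Ma + t * (m3 * a * b).
  by rewrite /Ma !((derD dD), (derM dD)) (Dk km1) (Dk km3) DaE DbE; ring.
have DMb : D Mb = t * Mb + s * (m3 * a * b).
  by rewrite /Mb !((derD dD), (derM dD)) (Dk km2) (Dk km3) DaE DbE; ring.
(* The relation is x d + y c d expanded. Its terms in ac, bc, abc cancel because the rows u and v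
   are proportional to x and y, and its constant term is x u0 + y c^2 v0. *)
have fin : x * u0 = y * c ^+ 2 * v0 -> albert_isotropic k a b c d.
  move=> e; exists (x * (u1) + y * v1 * c ^+ 2), (x * u2 + y * v2 * c ^+ 2),
    (x * u3 + y * v3 * c ^+ 2), (x * v0 + y * u0), x, y; split.
  - by split; ssr_closed.
  - by split; ssr_closed.
  - have -> : 0 = x * u0 + y * c ^+ 2 * v0 by rewrite e addFF.
    by rewrite dE U1 U2 U3 V1 V2 V3; ring2 F2.
  - by apply: contraL xy0 => /and5P[_ _ _ _ /andP[/eqP-> /eqP->]]; rewrite eqxx.
(* One identity for both cases: m is [Mb] or [Ma] and e is m3 a b, so that M + m + e is the other of
   the two. *)
have key m e : (x * u0 + y * c ^+ 2 * v0) * m = N * m * (u0 + v0 * c + N * M)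
    + (N * m) ^+ 2 + N * m * ((v0 + y * M) * c)
    + (y * c * m * (u0 + v0 * c + N * M) + N * (N * (M + m + e) * m + N * m * e)).
  have -> : x = N + y * c by rewrite /N; ring2 F2.
  by clearbody N M; ring2 F2.
have MaE : Ma = M + Mb + m3 * a * b by rewrite /Ma /M /Mb; ring2 F2.
have MbE : Mb = M + Ma + m3 * a * b by rewrite /Ma /M /Mb; ring2 F2.
(* Differentiating s d = N Mb and using D s = s + s^2 gives (x u0 + y c^2 v0) Mb = 0; the case of
   [Ma] is symmetric. *)
have [Mb0|Mb0] := eqVneq Mb 0; last first.
  apply: fin; apply: (addF_eq0 F2); apply: (mulIf Mb0); rewrite mul0r.
  have := congr1 D sd'; rewrite (derM dD s d) (derM dD N Mb) Ds DN DMb Dd'.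
  move=> /(congr1 (fun z => z * d)) h.
  have l : ((s + s ^+ 2) * d + s * ((v0 + y * M) * c)) * d =
    s * d * d + (s * d) ^+ 2 + s * d * ((v0 + y * M) * c) by ring.
  have r : (y * c * Mb + N * (t * Mb + s * (m3 * a * b))) * d =
    y * c * Mb * d + N * (t * d * Mb + s * d * (m3 * a * b)) by ring.
  move: h; rewrite l r sd' td' => /eqP; rewrite -subr_eq0 => /eqP <-.
  by rewrite dE' (oppF F2) MaE (key Mb (m3 * a * b)).
have [Ma0|Ma0] := eqVneq Ma 0; last first.
  apply: fin; apply: (addF_eq0 F2); apply: (mulIf Ma0); rewrite mul0r.
  have := congr1 D td'; rewrite (derM dD t d) (derM dD N Ma) Dt DN DMa Dd'.
  move=> /(congr1 (fun z => z * d)) h.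
  have l : ((t + t ^+ 2) * d + t * ((v0 + y * M) * c)) * d =
    t * d * d + (t * d) ^+ 2 + t * d * ((v0 + y * M) * c) by ring.
  have r : (y * c * Ma + N * (s * Ma + t * (m3 * a * b))) * d =
    y * c * Ma * d + N * (s * d * Ma + t * d * (m3 * a * b)) by ring.
  move: h; rewrite l r sd' td' => /eqP; rewrite -subr_eq0 => /eqP <-.
  by rewrite dE' (oppF F2) MbE (key Ma (m3 * a * b)).
have z0 : k 0 by exact: ssr0.
have [] := free2_coef z0 km1 z0 km3; first by rewrite -[RHS]Ma0 /Ma; ring.
move=> _ m10 _ m30; have [] := free2_coef z0 z0 km2 km3; first by rewrite -[RHS]Mb0 /Mb; ring.
move=> _ _ m20 _.
have dE0 : d = u0 + v0 * c by rewrite dE' /M m10 m20 m30; ring.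
(* The relation d + v0 c + u0 = 0 multiplied by c d. *)
exists 0, 0, 0, (v0 ^+ 2 * c ^+ 2 + u0 ^+ 2), (v0 * c ^+ 2), u0; split.
- by split.
- by split; ssr_closed.
- by rewrite dE0; ring2 F2.
- rewrite !eqxx /=; apply: contraNN d0 => /and3P[_ v00 /eqP u00].
  move: v00; rewrite mulf_eq0 sqrf_eq0 (negbTE c0) orbF => /eqP v00.
  by rewrite dE0 u00 v00 mul0r addr0.
Qed.

End DependentTower.

Section Isotropy.
Variable F : fieldType.
Hypothesis F2 : 2%:R = 0 :> F.
Implicit Types (k : F -> Prop) (D : F -> F).

Lemma free_swap2 k (x y z : F) s : square_subring k ->
  free k [:: x, y, z & s] -> free k [:: x, z, y & s].
Proof.
move=> k_sub [nkx fs]; split=> //.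
exact: (free_swap F2 (adj_square_subring k_sub x) fs).
Qed.

Lemma free_swap3 k (x y z t : F) s : square_subring k ->
  free k [:: x, y, z, t & s] -> free k [:: x, y, t, z & s].
Proof.
move=> k_sub [nkx fs]; split=> //.
exact: (free_swap2 (adj_square_subring k_sub x) fs).
Qed.

Lemma adj2_in k x y z : square_subring k -> k z -> adj (adj k x) y z.
Proof. by move=> k_sub kz; apply: (adj_in (adj_square_subring k_sub x)); exact: adj_in. Qed.

Lemma adj2_square_subring k x y : square_subring k -> square_subring (adj (adj k x) y).
Proof. by move=> k_sub; do 2!apply: adj_square_subring. Qed.

Lemma dlog1 D (x : F) : x != 0 -> D x = x -> dlog D x = 1.
Proof. by move=> x0; rewrite /dlog => ->; rewrite divff. Qed.

Lemma dlog0 D (x : F) : D x = 0 -> dlog D x = 0.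
Proof. by rewrite /dlog => ->; rewrite mul0r. Qed.

Section FixedField.
Variable k : F -> Prop.
Hypothesis k_sub : square_subring k.
Variables al be ga de a b : F.
Hypotheses (al0 : al != 0) (be0 : be != 0) (ga0 : ga != 0) (de0 : de != 0).
Hypotheses (a0 : a != 0) (b0 : b != 0).

Let same_form (x y z t : F) := forall D D', derivation D -> derivation D' ->
  kills D k -> kills D' k ->
  wedge D D' x y + wedge D D' z t = wedge D D' a b.

(** On the four dual derivations the form is 1 on (D1, D2) and (D3, D4) and 0 on the other pairs,
    which contradicts the Plücker relation for dlog a /\ dlog b. *)
Lemma same_form_not_free4 : same_form al be ga de ->
  ~ free k [:: al; be; ga; de].
Proof.
move=> W f.
have [D1 [d1 _ k1 e1 z1]] := free_dual F2 k_sub f.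
have [D2 [d2 _ k2 e2 z2]] := free_dual F2 k_sub (free_swap F2 k_sub f).
have f3 := free_swap2 k_sub f.
have [D3 [d3 _ k3 e3 z3]] := free_dual F2 k_sub (free_swap F2 k_sub f3).
have f4 := free_swap2 k_sub (free_swap3 k_sub f).
have [D4 [d4 _ k4 e4 z4]] := free_dual F2 k_sub (free_swap F2 k_sub f4).
have := wedge_pfaffian F2 D1 D2 D3 D4 a b; rewrite -!W //.
rewrite /wedge !(dlog1 al0 e1, dlog1 be0 e2, dlog1 ga0 e3, dlog1 de0 e4).
rewrite !(dlog0 (z1 be _), dlog0 (z1 ga _), dlog0 (z1 de _)) ?inE ?eqxx ?orbT //.
rewrite !(dlog0 (z2 al _), dlog0 (z2 ga _), dlog0 (z2 de _)) ?inE ?eqxx ?orbT //.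
rewrite !(dlog0 (z3 al _), dlog0 (z3 be _), dlog0 (z3 de _)) ?inE ?eqxx ?orbT //.
rewrite !(dlog0 (z4 al _), dlog0 (z4 be _), dlog0 (z4 ga _)) ?inE ?eqxx ?orbT //.
rewrite !(mulr0, mul0r, addr0, add0r, mulr1) => /eqP.
by rewrite oner_eq0.
Qed.

(** A derivation killing a and b lies in the kernel of the form. Once ga is known to lie outside
    k(a, b), a toral one with D ga = ga exists, and [albert_isotropic_kernel] applies. *)
Lemma same_form_free3 : same_form al be ga de -> free k [:: al; be; ga] ->
  adj (adj (adj k al) be) ga de -> albert_isotropic k al be ga de.
Proof.
move=> W f [_ [_ [[_ [_ [[u0 [u1 [ku0 ku1 ->]]] [u2 [u3 [ku2 ku3 ->]]] ->]]]
  [_ [_ [[v0 [v1 [kv0 kv1 ->]]] [v2 [v3 [kv2 kv3 ->]]] ->]]] dE]]].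
have [D1 [d1 _ k1 e1 z1]] := free_dual F2 k_sub f.
have [D2 [d2 _ k2 e2 z2]] := free_dual F2 k_sub (free_swap F2 k_sub f).
have f3 := free_swap2 k_sub f.
have [D3 [d3 _ k3 e3 z3]] := free_dual F2 k_sub (free_swap F2 k_sub f3).
have z1b : D1 be = 0 by apply: z1; rewrite !inE eqxx.
have z1g : D1 ga = 0 by apply: z1; rewrite !inE eqxx orbT.
have z2a : D2 al = 0 by apply: z2; rewrite !inE eqxx.
have z2g : D2 ga = 0 by apply: z2; rewrite !inE eqxx orbT.
have z3a : D3 al = 0 by apply: z3; rewrite !inE eqxx.
have z3b : D3 be = 0 by apply: z3; rewrite !inE eqxx orbT.
have D1de : D1 de = (u1 * al + u3 * al * be + (v1 * al + v3 * al * be) * ga).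
  rewrite dE !((derD d1), (derM d1)) e1 z1b z1g (k1 _ ku0) (k1 _ ku1) (k1 _ ku2).
  by rewrite (k1 _ ku3) (k1 _ kv0) (k1 _ kv1) (k1 _ kv2) (k1 _ kv3); ring.
have D2de : D2 de = (u2 * be + u3 * al * be + (v2 * be + v3 * al * be) * ga).
  rewrite dE !((derD d2), (derM d2)) e2 z2a z2g (k2 _ ku0) (k2 _ ku1) (k2 _ ku2).
  by rewrite (k2 _ ku3) (k2 _ kv0) (k2 _ kv1) (k2 _ kv2) (k2 _ kv3); ring.
pose kab := adj (adj k a) b.
have kab_sub : square_subring kab by do 2!apply: adj_square_subring.
have ker D : derivation D -> kills D kab ->
    dlog D be = dlog D ga * (D1 de / de) /\ dlog D al = dlog D ga * (D2 de / de).
  move=> dD Dkab.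
  have Dk : kills D k by move=> x kx; apply: Dkab; exact: adj2_in.
  have Da : dlog D a = 0 by apply/dlog0/Dkab/adj_in; [exact: adj_square_subring|exact: adj_gen].
  have Db : dlog D b = 0 by apply/dlog0/Dkab/adj_gen/adj_square_subring.
  have := W D D1 dD d1 Dk k1; have := W D D2 dD d2 Dk k2.
  rewrite /wedge Da Db !mul0r !mulr0 addr0 !(dlog1 al0 e1, dlog1 be0 e2).
  rewrite (dlog0 z1b) (dlog0 z1g) (dlog0 z2a) (dlog0 z2g) !(mul0r, mulr0, mulr1, mul1r, addr0, add0r).
  by move=> /(addF_eq0 F2) h2 /(addF_eq0 F2) h1.
have nkab : ~ kab ga.
  move=> kga.
  have notin x : x = al \/ x = be -> kab x.
    move=> xE; apply: contrapT => nx.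
    have [D [dD tD Dkab Dx]] := exists_toral F2 kab_sub nx.
    have [hb ha] := ker D dD Dkab.
    have Dga : dlog D ga = 0 by apply/dlog0/Dkab.
    have := oner_neq0 F; case: xE Dx => -> Dx.
    - by rewrite -(dlog1 al0 Dx) ha Dga mul0r eqxx.
    - by rewrite -(dlog1 be0 Dx) hb Dga mul0r eqxx.
  have kal := notin al (or_introl erefl); have kbe := notin be (or_intror erefl).
  (* Expansion of the 3 by 3 determinant with columns dlog Di a, dlog Di b and Di x: it vanishes at
     a and b, but equals ga at x = ga. *)
  pose E x := (dlog D2 a * dlog D3 b + dlog D3 a * dlog D2 b) * D1 x
     + ((dlog D1 a * dlog D3 b + dlog D3 a * dlog D1 b) * D2 x
     + (dlog D1 a * dlog D2 b + dlog D2 a * dlog D1 b) * D3 x).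
  have w12 : dlog D1 a * dlog D2 b + dlog D2 a * dlog D1 b = 1.
    rewrite -[LHS]W // /wedge (dlog1 al0 e1) (dlog1 be0 e2) (dlog0 z2a) (dlog0 z1b).
    by rewrite (dlog0 z1g) (dlog0 z2g) !(mul0r, mulr0, mulr1, mul1r, addr0, add0r).
  have dE' : derivation E by do 2?apply: derivation_add; exact: derivation_scale.
  have Ea : E a = 0.
    rewrite /E -[D1 a](divfK a0) -[D2 a](divfK a0) -[D3 a](divfK a0).
    by rewrite -!/(dlog _ a); ring2 F2.
  have Eb : E b = 0.
    rewrite /E -[D1 b](divfK b0) -[D2 b](divfK b0) -[D3 b](divfK b0).
    by rewrite -!/(dlog _ b); ring2 F2.
  have : E ga = 0.
    have [_ [_ [[x [y [kx ky ->]]] [x' [y' [kx' ky' ->]]] ->]]] := kga.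
    have Ek z : k z -> E z = 0 by move=> kz; rewrite /E k1 // k2 // k3 //; ring.
    by rewrite !((derD dE'), (derM dE')) Ea Eb !Ek //; ring.
  by rewrite /E w12 z1g z2g e3 !mulr0 !add0r mul1r => /eqP; exact/negP.
have [D [dD tD Dkab Dga]] := exists_toral F2 kab_sub nkab.
have [hb ha] := ker D dD Dkab.
rewrite (dlog1 ga0 Dga) mul1r in ha; rewrite (dlog1 ga0 Dga) mul1r in hb.
apply: (albert_isotropic_kernel F2 k_sub f ku0 ku1 ku2 ku3 kv0 kv1 kv2 kv3 dE de0 dD tD _ Dga).
- by move=> x kx; apply: Dkab; exact: adj2_in.
- by rewrite -D2de -[D al](divfK al0) -/(dlog D al) ha mulrA [de * _]mulrC divfK.
- by rewrite -D1de -[D be](divfK be0) -/(dlog D be) hb mulrA [de * _]mulrC divfK.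
Qed.

End FixedField.

(** Failing isotropy, al and be are independent over k. If ga and de both lie in k(al, be), a
    dimension count applies; otherwise one of them is a third independent element, and the Plücker
    relation makes the fourth dependent. *)
Lemma albert_isotropic_same_form k (al be ga de a b : F) : square_subring k ->
  al != 0 -> be != 0 -> ga != 0 -> de != 0 -> a != 0 -> b != 0 ->
  (forall D D', derivation D -> derivation D' -> kills D k -> kills D' k ->
     wedge D D' al be + wedge D D' ga de = wedge D D' a b) ->
  albert_isotropic k al be ga de.
Proof.
move=> k_sub al0 be0 ga0 de0 a0 b0 W; apply: contrapT => niso.
have fab : free k [:: al; be].
  apply: free_pair => // p; apply: niso; exact: albert_isotropic_pure_left.
have gen g d : g != 0 -> d != 0 -> (forall D D', derivation D -> derivation D' -> kills D k -> kills D' k ->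
     wedge D D' al be + wedge D D' g d = wedge D D' a b) ->
   ~ adj (adj k al) be g -> albert_isotropic k al be g d.
  move=> g0 d0 W' ng.
  have f3 : free k [:: al; be; g] by case: fab => ? [? _].
  have [hd|nd] := pselect (adj (adj (adj k al) be) g d).
    exact: (same_form_free3 k_sub al0 be0 g0 d0 a0 b0 W').
  case: (same_form_not_free4 k_sub al0 be0 g0 d0 W').
  by case: f3 => ? [? [? _]].
have [hg|] := pselect (adj (adj k al) be ga); last by move=> ng; apply: niso; exact: gen.
have [hd|nd] := pselect (adj (adj k al) be de).
  by apply: niso; exact: albert_isotropic_small.
apply: niso; apply: albert_isotropic_swap; apply: gen => // D D' *.
by rewrite (wedgeC D D' de); exact: W.
Qed.

End Isotropy.

(** * Slots and linkage of symbols *)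

Section Linkage.
Variable F : fieldType.
Hypothesis F2 : 2%:R = 0 :> F.
Implicit Types (a b c d x y z n m : F).

Lemma wedge_sum_eq (s : seq (F * F)) (D D' : F -> F) :
  derivation D -> derivation D' -> all (fun p => (p.1 != 0) && (p.2 != 0)) s ->
  \sum_(p <- s) sy p.1 p.2 = 0 -> \sum_(p <- s) wedge D D' p.1 p.2 = 0.
Proof.
move=> dD dD' s0 e; have [om [omD omE]] := exists_log_form F2 dD dD'.
have om0 : om 0 = 0 by have := omD 0 0; rewrite addr0 => /eqP; rewrite -subr_eq0 opprD addNKr oppr_eq0 => /eqP.
suff <- : om (\sum_(p <- s) sy p.1 p.2) = \sum_(p <- s) wedge D D' p.1 p.2 by rewrite e om0.
elim: s s0 {e} => [|p s IH] /=; first by rewrite !big_nil om0.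
move=> /andP[/andP[p1 p2] s0]; rewrite !big_cons omD omE !val_unit_of //.
by rewrite IH.
Qed.

Lemma wedge_sy_eq a b c d D D' : derivation D -> derivation D' ->
  a != 0 -> b != 0 -> c != 0 -> d != 0 ->
  sy a b = sy c d -> wedge D D' a b = wedge D D' c d.
Proof.
move=> dD dD' a0 b0 c0 d0 e; apply: (addF_eq0 F2).
have := @wedge_sum_eq [:: (a, b); (c, d)] D D' dD dD'.
by rewrite /= a0 b0 c0 d0 !big_cons !big_nil /= !addr0 e (K2mod2_addxx (sy c d)); apply.
Qed.

Lemma wedge_sy_eq2 a b c d x y z t D D' : derivation D -> derivation D' ->
  a != 0 -> b != 0 -> c != 0 -> d != 0 -> x != 0 -> y != 0 -> z != 0 -> t != 0 ->
  sy a b + sy c d = sy x y + sy z t ->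
  wedge D D' a b + wedge D D' c d = wedge D D' x y + wedge D D' z t.
Proof.
move=> dD dD' a0 b0 c0 d0 x0 y0 z0 t0 e; apply: (addF_eq0 F2).
have := @wedge_sum_eq [:: (a, b); (c, d); (x, y); (z, t)] D D' dD dD'.
rewrite /= a0 b0 c0 d0 x0 y0 z0 t0 !big_cons !big_nil /= !addr0 !addrA.
by rewrite e -(addrA (sy x y + _)) (K2mod2_addxx (sy x y + _)); apply.
Qed.

Lemma sy_mul_norm a b x y : b != 0 -> b * (x ^+ 2 + a * y ^+ 2) != 0 ->
  sy a (b * (x ^+ 2 + a * y ^+ 2)) = sy a b.
Proof.
move=> b0 n0; have n0' : x ^+ 2 + a * y ^+ 2 != 0.
  by apply: contraNneq n0 => ->; rewrite mulr0.
by rewrite syMr // sy_norm // addr0.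
Qed.

(** The value is x^2 a + w, where w is b times a norm, so {a, b} = {a, w}; then [sy_addM] makes the
    sum a slot. *)
Lemma pure_slot a b x y z : a != 0 -> b != 0 ->
  x ^+ 2 * a + y ^+ 2 * b + z ^+ 2 * (a * b) != 0 ->
  exists2 m, m != 0 & sy a b = sy (x ^+ 2 * a + y ^+ 2 * b + z ^+ 2 * (a * b)) m.
Proof.
move=> a0 b0; pose w := b * (y ^+ 2 + a * z ^+ 2).
have -> : x ^+ 2 * a + y ^+ 2 * b + z ^+ 2 * (a * b) = x ^+ 2 * a + w by rewrite /w; ring.
have [w0|w0] := eqVneq w 0.
  rewrite w0 addr0 mulf_eq0 negb_or sqrf_eq0 => /andP[x0 _].
  by exists b; rewrite // sy_sqrMl.
have <- := sy_mul_norm b0 w0; rewrite -/w => n0.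
have [x0|x0] := eqVneq x 0.
  by exists a => //; rewrite x0 expr0n mul0r add0r (syC F2).
have xa0 : x ^+ 2 * a != 0 by rewrite mulf_neq0 ?sqrf_eq0.
exists (x ^+ 2 * a * w); first by rewrite mulf_neq0.
by rewrite (sy_addM F2) // sy_sqrMl.
Qed.

(** A zero reads x^2 a = w with w equal to b times a norm. If w is nonzero, {a, b} = {a, w} = {a, a}
    = 0; otherwise a is a square. *)
Lemma pure_isotropic_sy a b : a != 0 -> b != 0 ->
  pure_isotropic squares a b -> sy a b = 0.
Proof.
move=> a0 b0 [_ [_ [_ [[[x ->] [y ->] [z ->]] e nz]]]].
pose w := b * (y ^+ 2 + a * z ^+ 2).
have {}e : x ^+ 2 * a = w by apply: (addF_eq0 F2); rewrite -[RHS]e /w; ring.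
have [w0|w0] := eqVneq w 0; last first.
  have <- := sy_mul_norm b0 w0; rewrite -/w -e sy_sqrMr ?sy_aa //.
  by apply: contraNneq w0 => x0; rewrite -e x0 expr0n mul0r.
move/eqP: w0; rewrite {1}/w mulf_eq0 (negbTE b0) /= => /eqP/(addF_eq0 F2) yz.
move/eqP: e nz; rewrite [w](_ : _ = 0); last by rewrite /w yz addFF // mulr0.
rewrite mulf_eq0 (negbTE a0) orbF => -> /= nz.
have z0 : z != 0 by apply: contraNneq nz => z0; rewrite yz z0 expr0n mulr0 eqxx.
have -> : a = (y / z) ^+ 2 by rewrite expr_div_n yz mulfK // sqrf_eq0.
by rewrite sy_sqrl.
Qed.

Lemma sy_adj a b : adj squares a b -> sy a b = 0.
Proof.
move=> [_ [_ [[x ->] [y ->] ->]]]; rewrite [_ * a]mulrC; exact: sy_norm.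
Qed.

Lemma sy_squares a b : squares a -> sy a b = 0.
Proof. by move=> [x ->]; rewrite sy_sqrl. Qed.

Lemma sy_free a b : sy a b != 0 -> free squares [:: a; b].
Proof.
move=> ab0; split; first by move=> /(sy_squares b) e; rewrite e eqxx in ab0.
by split=> // /sy_adj e; rewrite e eqxx in ab0.
Qed.

(** Otherwise some D kills a and b with D c = c; paired with a derivation dual to d over F^2(c), it
    gives 0 for {a, b} and 1 for {c, d}. *)
Lemma sy_adj2 a b c d : a != 0 -> b != 0 -> c != 0 -> d != 0 ->
  sy a b = sy c d -> sy c d != 0 -> adj (adj squares a) b c.
Proof.
move=> a0 b0 c0 d0 e cd0; apply: contrapT => nc.
have sq := square_subring_squares F2.
have [D [dD tD Dk Dc]] := exists_toral F2 (adj2_square_subring a b sq) nc.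
have Da : dlog D a = 0 by apply/dlog0/Dk/adj_in; [exact: adj_square_subring|exact: adj_gen].
have Db : dlog D b = 0 by apply/dlog0/Dk/adj_gen/adj_square_subring.
have [_ [nd _]] := sy_free cd0.
have [D' [dD' _ Dk' Dd']] := exists_toral F2 (adj_square_subring sq c) nd.
have Dc' : D' c = 0 by apply/Dk'/adj_gen.
have := wedge_sy_eq dD dD' a0 b0 c0 d0 e; rewrite /wedge Da Db (dlog0 Dc') (dlog1 c0 Dc).
by rewrite (dlog1 d0 Dd') !(mul0r, mulr0, addr0, mulr1) => /eqP; rewrite eq_sym oner_eq0.
Qed.

(* Write c = x^2 + n with n in the pure part of F^2(a, b). The derivations dual
   to n and a second slot m of {n, m} = {a, b} then show that x = 0. *)
Lemma slot_pure a b c d : a != 0 -> b != 0 -> c != 0 -> d != 0 ->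
  sy a b = sy c d -> sy c d != 0 ->
  exists x y z, c = x ^+ 2 * a + y ^+ 2 * b + z ^+ 2 * (a * b).
Proof.
move=> a0 b0 c0 d0 e cd0.
have [_ [_ [[_ [_ [[w ->] [x ->] ->]]] [_ [_ [[y ->] [z ->] ->]]] cE]]] :=
  sy_adj2 a0 b0 c0 d0 e cd0.
set n := x ^+ 2 * a + y ^+ 2 * b + z ^+ 2 * (a * b).
have {}cE : c = w ^+ 2 + n by rewrite cE /n; ring.
have n0 : n != 0.
  apply/eqP => n0; apply: (elimN eqP cd0); by rewrite cE n0 addr0 sy_sqrl.
have [m m0 nm] := pure_slot a0 b0 n0; rewrite -/n in nm.
have nm0 : sy n m != 0 by rewrite -nm e.
have sq := square_subring_squares F2.
have [D' [dD' _ _ Dn' Dm']] := free_dual F2 sq (sy_free nm0).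
have [D [dD tD _ Dm Dn]] := free_dual F2 sq (free_swap F2 sq (sy_free nm0)).
have {}Dn : D n = 0 by apply: Dn; rewrite inE.
have {}Dm' : D' m = 0 by apply: Dm'; rewrite inE.
have Dc : D c = 0 by rewrite cE (derD dD) (der_sqr F2 dD) Dn addr0.
have Dc' : D' c = n by rewrite cE (derD dD') (der_sqr F2 dD') Dn' add0r.
have := wedge_sy_eq dD dD' n0 m0 c0 d0 (etrans (esym nm) e).
rewrite /wedge (dlog0 Dn) (dlog0 Dc) (dlog0 Dm') (dlog1 n0 Dn') (dlog1 m0 Dm).
rewrite !(mul0r, add0r, mul1r) /dlog Dc' => h.
have Dd : D d = c / n * d.
  have := congr1 (fun t => c / n * d * t) h.
  rewrite mulr1 => ->; field; by rewrite d0 c0 n0.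
have Dcn : D (c / n) = 0 by rewrite (derM dD) Dc (derV F2 dD) Dn; ring.
(* D kills c / n and D d = (c / n) d, so D^2 = D makes c / n idempotent. *)
have := tD d; rewrite Dd (derM dD) Dcn mul0r add0r Dd mulrA => /(mulIf d0).
have cn0 : c / n != 0 by rewrite mulf_neq0 ?invr_eq0.
rewrite -[X in _ = X]mulr1 => /(mulfI cn0) cn1.
by exists x, y, z; rewrite -/n -[c](divfK n0) cn1 mul1r.
Qed.

Lemma sum_symbol_isotropic a b c d x y :
  a != 0 -> b != 0 -> c != 0 -> d != 0 -> x != 0 -> y != 0 ->
  sy a b + sy c d = sy x y -> albert_isotropic squares a b c d.
Proof.
move=> a0 b0 c0 d0 x0 y0 e.
apply: (albert_isotropic_same_form F2 (square_subring_squares F2) a0 b0 c0 d0 x0 y0).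
move=> D D' dD dD' _ _.
have := @wedge_sy_eq2 a b c d x y 1 1 D D' dD dD' a0 b0 c0 d0 x0 y0 (oner_neq0 _) (oner_neq0 _).
rewrite sy1l addr0 => /(_ e) ->.
by rewrite /wedge /dlog (der1 F2 dD) !mul0r mulr0 !addr0.
Qed.

(** A zero of the Albert form is a common value of the two pure parts, hence a common slot; if that
    value is 0, one of the symbols vanishes. *)
Lemma albert_isotropic_linked a b c d :
  a != 0 -> b != 0 -> c != 0 -> d != 0 -> albert_isotropic squares a b c d ->
  exists p q r, [/\ p != 0, q != 0, r != 0, sy a b = sy p q & sy c d = sy p r].
Proof.
move=> a0 b0 c0 d0 [_ [_ [_ [_ [_ [_ [[[x1 ->] [x2 ->] [x3 ->]] [[x4 ->] [x5 ->] [x6 ->]] e nz]]]]]]].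
have {}e : x1 ^+ 2 * a + x2 ^+ 2 * b + x3 ^+ 2 * (a * b)
     = x4 ^+ 2 * c + x5 ^+ 2 * d + x6 ^+ 2 * (c * d).
  by apply: (addF_eq0 F2); rewrite -[RHS]e; ring.
have sqI x : squares (x ^+ 2) by exists x.
have [p0|p0] := eqVneq (x1 ^+ 2 * a + x2 ^+ 2 * b + x3 ^+ 2 * (a * b)) 0; last first.
  have [q q0 ->] := pure_slot a0 b0 p0.
  rewrite e in p0 *; have [r r0 ->] := pure_slot c0 d0 p0.
  by exists (x4 ^+ 2 * c + x5 ^+ 2 * d + x6 ^+ 2 * (c * d)), q, r.
have [z1|z1] := boolP [&& x1 ^+ 2 == 0, x2 ^+ 2 == 0 & x3 ^+ 2 == 0].
  have -> : sy c d = 0.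
    apply: pure_isotropic_sy => //; exists (x4 ^+ 2), (x5 ^+ 2), (x6 ^+ 2); split=> //.
    - by rewrite -e.
    - by apply: contra nz => z2; case/and3P: z1 => -> -> ->.
  by exists a, b, 1; rewrite sy1r oner_neq0.
have -> : sy a b = 0.
  by apply: pure_isotropic_sy => //; exists (x1 ^+ 2), (x2 ^+ 2), (x3 ^+ 2).
by exists c, 1, d; rewrite sy1r oner_neq0.
Qed.

End Linkage.

(** * Orthogonal frames of a diagonal form of dimension 6 *)

Lemma exists_kernel (F : fieldType) n m (A : 'M[F]_(n, m)) : (m < n)%N ->
  exists2 v : 'rV[F]_n, v != 0 & v *m A = 0.
Proof.
move=> mn; have /rowV0Pn[v /sub_kermxP vA v0] : kermx A != 0.
  by rewrite kermx_eq0 /row_free neq_ltn (leq_ltn_trans (rank_leq_col _)).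
by exists v.
Qed.

Section DiagonalForm.
Variable F : fieldType.
Hypothesis F2 : 2%:R = 0 :> F.
Variable g : 'I_6 -> F.
Implicit Types (u v w : 'rV[F]_6) (L R X : seq 'rV[F]_6) (p q r : F).

(** In characteristic 2 the polar form of the quadratic form is zero. Orthogonality refers instead
    to this diagonal symmetric form, and anisotropy excludes self-orthogonal vectors. *)
Definition bil u v : F := \sum_i g i * u 0 i * v 0 i.
Definition qf v : F := bil v v.

Hypothesis aniso : forall v, qf v = 0 -> v = 0.

Lemma bilC u v : bil u v = bil v u.
Proof. by apply: eq_bigr => i _; ring. Qed.

Lemma bilDl u v w : bil (u + v) w = bil u w + bil v w.
Proof. by rewrite -big_split; apply: eq_bigr => i _ /=; rewrite !mxE; ring. Qed.

Lemma bilZl c u w : bil (c *: u) w = c * bil u w.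
Proof. by rewrite big_distrr; apply: eq_bigr => i _ /=; rewrite !mxE; ring. Qed.

Lemma bil0l w : bil 0 w = 0.
Proof. by rewrite /bil big1 // => i _; rewrite !mxE mulr0 mul0r. Qed.

Lemma bil_suml n (c : 'I_n -> F) (f : 'I_n -> 'rV[F]_6) w :
  bil (\sum_i c i *: f i) w = \sum_i c i * bil (f i) w.
Proof.
elim/big_rec2: _ => [|i y1 y2 _ <-]; first exact: bil0l.
by rewrite bilDl bilZl.
Qed.

Definition orth L : bool :=
  pairwise (fun u v => bil u v == 0) L && all (fun v => v != 0) L.

Definition perp v X : bool := all (fun x => bil v x == 0) X.

Lemma perp_cons v x X : perp v (x :: X) = (bil v x == 0) && perp v X.
Proof. by []. Qed.

Lemma perpP v X : reflect {in X, forall x, bil v x = 0} (perp v X).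
Proof. by apply: (iffP allP) => h x /h => [/eqP|->]. Qed.

Lemma orth_cons v L : orth (v :: L) = [&& v != 0, perp v L & orth L].
Proof. by rewrite /orth /= /perp; case: (v != 0); rewrite ?andbF //= andbAC andbA andbAC. Qed.

Lemma qf_neq0 v : v != 0 -> qf v != 0.
Proof. by apply: contra_neq; exact: aniso. Qed.

Lemma orth_cross L1 L2 u v : orth (L1 ++ L2) -> u \in L1 -> v \in L2 -> bil u v = 0.
Proof.
rewrite /orth pairwise_cat => /andP[/and3P[/allrelP h _ _] _] uL vL.
by apply/eqP; exact: h.
Qed.

Lemma exists_perp X : (size X < 6)%N -> exists2 v, v != 0 & perp v X.
Proof.
move=> sX; pose M := \matrix_(i < 6, j < size X) (g i * (nth 0 X j) 0 i).
have [v v0 vM] := exists_kernel M sX.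
exists v => //; apply/perpP => x xX.
have jX : (index x X < size X)%N by rewrite index_mem.
have := congr1 (fun m : 'rV_(size X) => m 0 (Ordinal jX)) vM; rewrite !mxE => <-.
by apply: eq_bigr => i _; rewrite !mxE /= nth_index //; ring.
Qed.

Lemma orth_size L : orth L -> (size L <= 6)%N.
Proof.
move=> /andP[pL nL]; rewrite leqNgt; apply/negP => sL.
pose M := \matrix_(i < size L) (nth 0 L i : 'rV[F]_6).
have [c /negP c0 cM] := exists_kernel M sL; apply: c0.
apply/eqP/rowP => j; rewrite mxE.
have nj : qf (nth 0 L j) != 0 by apply: qf_neq0; exact: (allP nL) (mem_nth _ _).
apply: (mulIf nj); rewrite mul0r.
have e : \sum_i c 0 i *: nth 0 L i = 0.
  by rewrite -[RHS]cM mulmx_sum_row; apply: eq_bigr => i _; rewrite rowK.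
have := bil_suml (fun i => c 0 i) (fun i : 'I_(size L) => nth 0 L i) (nth 0 L j).
rewrite e bil0l (bigD1 j) //= big1 ?addr0 // => i ij.
suff -> : bil (nth 0 L i) (nth 0 L j) = 0 by rewrite mulr0.
have /(pairwiseP 0) pw := pL; have [lij|lji|/val_inj eij] := ltngtP i j.
- by apply/eqP/pw => //; rewrite inE.
- by rewrite bilC; apply/eqP/pw => //; rewrite inE.
- by rewrite eij eqxx in ij.
Qed.

Lemma orth_total L v : orth L -> size L = 6%N -> perp v L -> v = 0.
Proof.
move=> oL sL pv; apply/eqP/negPn/negP => v0.
have /orth_size : orth (v :: L) by rewrite orth_cons v0 pv.
by rewrite /= sL.
Qed.

Lemma orthP L : reflect
  [/\ uniq L, {in L, forall v, v != 0} & {in L &, forall u v, u != v -> bil u v = 0}]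
  (orth L).
Proof.
elim: L => [|v L IH]; first by apply: ReflectT; split.
rewrite orth_cons; apply: (iffP and3P) => [[v0 /perpP pv /IH[uL nL oL]]|[/= /andP[vL uL] nL oL]].
  split.
  - rewrite /= uL andbT; apply/negP => /pv e; move: v0; by rewrite (aniso e) eqxx.
  - by move=> u; rewrite inE => /orP[/eqP->//|/nL].
  - move=> u w; rewrite !inE => /orP[/eqP->|uL'] /orP[/eqP->|wL'].
    + by rewrite eqxx.
    + by move=> _; exact: pv.
    + by move=> _; rewrite bilC; exact: pv.
    + exact: oL.
split.
- by apply: nL; rewrite inE eqxx.
- apply/perpP => x xL; apply: oL; rewrite ?inE ?eqxx ?xL ?orbT //.
  by apply: contraNneq vL => ->.
- apply/IH; split=> // [u uL'|u w uL' wL']; first by apply: nL; rewrite inE uL' orbT.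
  by apply: oL; rewrite inE ?uL' ?wL' orbT.
Qed.

Lemma orth_perm L L' : perm_eq L L' -> orth L -> orth L'.
Proof.
move=> pL /orthP[uL nL oL]; apply/orthP; split; first by rewrite -(perm_uniq pL).
- by move=> v; rewrite -(perm_mem pL); exact: nL.
- by move=> u v; rewrite -!(perm_mem pL); exact: oL.
Qed.

End DiagonalForm.

Ltac orth_reorder H := apply: (orth_perm _ _ H); [assumption | clear; apply/permP => ? /=; lia].

Section Signatures.
Variable F : fieldType.
Hypothesis F2 : 2%:R = 0 :> F.
Variable g : 'I_6 -> F.
Implicit Types (u v w : 'rV[F]_6) (L R X : seq 'rV[F]_6) (p q r : F).
Hypothesis aniso : forall v, qf g v = 0 -> v = 0.

Local Notation bil := (bil g).
Local Notation qf := (qf g).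
Local Notation perp := (perp g).
Local Notation orth := (orth g).

Lemma bilDr u v w : bil w (u + v) = bil w u + bil w v.
Proof. by rewrite bilC bilDl !(bilC _ w). Qed.

Lemma bilZr c u w : bil w (c *: u) = c * bil w u.
Proof. by rewrite bilC bilZl (bilC _ w). Qed.

Lemma qf_lin x y u v : bil u v = 0 ->
  qf (x *: u + y *: v) = x ^+ 2 * qf u + y ^+ 2 * qf v.
Proof.
move=> uv; rewrite /qf !(bilDl, bilDr, bilZl, bilZr) (bilC _ v u) uv; ring.
Qed.

Lemma perp_expand u v R w : orth [:: u, v & R] -> size R = 4%N -> perp w R ->
  exists x y, w = x *: u + y *: v.
Proof.
move=> o sR wR; exists (bil w u / qf u), (bil w v / qf v).
have := o; rewrite !orth_cons perp_cons => /and3P[u0 /andP[/eqP uv uR] /and3P[v0 vR _]].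
apply/eqP; rewrite -subr_eq0; apply/eqP; apply: (orth_total aniso o); first by rewrite /= sR.
apply/perpP => z zL; rewrite bilDl -scaleN1r bilZl bilDl !bilZl.
move: zL; rewrite !inE => /or3P[/eqP->|/eqP->|zR].
- by rewrite -/(qf u) (bilC _ v u) uv mulr0 addr0 divfK ?(qf_neq0 aniso) // mulN1r subrr.
- by rewrite -/(qf v) uv mulr0 add0r divfK ?(qf_neq0 aniso) // mulN1r subrr.
- by rewrite (perpP _ _ _ wR) // (perpP _ _ _ uR) // (perpP _ _ _ vR) //; ring.
Qed.

(** Both pairs are bases of the plane orthogonal to R; d is the determinant of the change of basis,
    by the Lagrange identity. *)
Lemma plane_move u v u' v' R : orth [:: u, v & R] -> orth [:: u', v' & R] ->
  size R = 4%N ->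
  exists x y d, [/\ u' = x *: u + y *: v, qf u' = x ^+ 2 * qf u + y ^+ 2 * qf v
    & qf u' * qf v' = d ^+ 2 * (qf u * qf v)].
Proof.
move=> o o' sR.
have := o; rewrite !orth_cons perp_cons => /and3P[u0 /andP[/eqP uv uR] /and3P[v0 vR _]].
have := o'; rewrite !orth_cons perp_cons => /and3P[u0' /andP[/eqP uv' uR'] /and3P[v0' vR' _]].
have [x [y uE]] := perp_expand o sR uR'.
have [z [t vE]] := perp_expand o sR vR'.
have e : x * z * qf u + y * t * qf v = 0.
  by rewrite -uv' uE vE !(bilDl, bilDr, bilZl, bilZr) (bilC _ v u) uv /qf; ring.
exists x, y, (x * t + y * z); split=> //; first by rewrite uE qf_lin.
rewrite uE vE !qf_lin //.
have -> : (x ^+ 2 * qf u + y ^+ 2 * qf v) * (z ^+ 2 * qf u + t ^+ 2 * qf v)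
   = (x * z * qf u + y * t * qf v) ^+ 2 + (x * t + y * z) ^+ 2 * (qf u * qf v) by ring2 F2.
by rewrite e expr0n add0r.
Qed.

(* The form <p, q, r> is similar to the pure part <a, b, ab> of the symbol
   {a, b} = {p q, p r}. *)
Definition sig p q r : K2mod2 F := sy (p * q) (p * r).

Lemma sigE p q r : p != 0 -> q != 0 -> r != 0 -> sig p q r = sy (p * q) (q * r).
Proof.
move=> p0 q0 r0; rewrite /sig -[LHS]addr0 -(sy_aa F2 (p * q)) -syMr ?mulf_neq0 //.
by rewrite (_ : p * r * (p * q) = p ^+ 2 * (q * r)) ?sy_sqrMr //; ring.
Qed.

Lemma sigC p q r : sig p q r = sig p r q.
Proof. exact: syC. Qed.

Lemma sig_rot p q r : p != 0 -> q != 0 -> r != 0 -> sig p q r = sig q p r.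
Proof. by move=> p0 q0 r0; rewrite sigE // /sig [q * p]mulrC. Qed.

(** As p q' = x^2 p q + y^2 p r, [sy_addM] replaces {p q, p r} by {p q', q r}, and q r is q' r' up
    to a square. *)
Lemma sig_plane p q r q' r' x y d :
  p != 0 -> q != 0 -> r != 0 -> q' != 0 -> r' != 0 ->
  q' = x ^+ 2 * q + y ^+ 2 * r -> q' * r' = d ^+ 2 * (q * r) ->
  sig p q r = sig p q' r'.
Proof.
move=> p0 q0 r0 q0' r0' qE dE.
have d0 : d != 0.
  apply: contraNneq (mulf_neq0 q0' r0') => d0; by rewrite dE d0 expr0n mul0r.
rewrite [RHS]sigE // dE sy_sqrMr //.
have [y0|y0] := eqVneq y 0.
  have x0 : x != 0.
    by apply: contraNneq q0' => x0; rewrite qE x0 y0 expr0n !mul0r addr0.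
  by rewrite qE y0 expr0n mul0r addr0 mulrCA sy_sqrMl // sigE.
have [x0|x0] := eqVneq x 0.
  by rewrite qE x0 expr0n mul0r add0r mulrCA sy_sqrMl // sigC sigE // [r * q]mulrC.
have a0 : x ^+ 2 * (p * q) != 0 by rewrite !mulf_neq0 ?sqrf_eq0.
have b0 : y ^+ 2 * (p * r) != 0 by rewrite !mulf_neq0 ?sqrf_eq0.
have E : p * q' = x ^+ 2 * (p * q) + y ^+ 2 * (p * r) by rewrite qE; ring.
rewrite /sig; have := sy_addM F2 a0 b0; rewrite -E mulf_neq0 // sy_sqrMl // sy_sqrMr // => <- //.
rewrite (_ : x ^+ 2 * (p * q) * (y ^+ 2 * (p * r)) = (x * y * p) ^+ 2 * (q * r)); last by ring.
by rewrite sy_sqrMr ?mulf_neq0.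
Qed.

Definition sigv u v w := sig (qf u) (qf v) (qf w).

Lemma orth_neq0 L v : orth L -> v \in L -> v != 0.
Proof. by move=> /(orthP aniso)[_ nL _]; exact: nL. Qed.

Lemma sigv_plane u v w v' w' R : orth [:: u, v, w & R] -> orth [:: u, v', w' & R] ->
  size R = 3%N -> sigv u v w = sigv u v' w'.
Proof.
move=> o o' sR.
have nz z : z \in [:: u, v, w & R] -> qf z != 0 by move=> zL; exact/(qf_neq0 aniso)/(orth_neq0 o).
have nz' z : z \in [:: u, v', w' & R] -> qf z != 0 by move=> zL; exact/(qf_neq0 aniso)/(orth_neq0 o').
have p : orth [:: v, w, u & R] by orth_reorder o.
have p' : orth [:: v', w', u & R] by orth_reorder o'.
have [|x [y [d [_ e1 e2]]]] := plane_move p p'; first by rewrite /= sR.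
by apply: sig_plane e1 e2;
  first [by apply: nz; rewrite !inE eqxx ?orbT | by apply: nz'; rewrite !inE eqxx ?orbT].
Qed.

Lemma sigv_rot u v w R : orth [:: u, v, w & R] ->
  sigv u v w = sigv v u w /\ sigv u v w = sigv u w v.
Proof.
move=> o; split; last exact: sigC.
by apply: sig_rot; apply/(qf_neq0 aniso)/(orth_neq0 o); rewrite !inE eqxx ?orbT.
Qed.

Lemma exists_orth L X : orth L -> (size L + size X < 6)%N ->
  exists2 v, orth (v :: L) & perp v X.
Proof.
move=> oL s; have [|v v0] := @exists_perp _ g (L ++ X); first by rewrite size_cat.
by rewrite /perp all_cat => /andP[vL vX]; exists v; rewrite // orth_cons v0 /perp vL.
Qed.

(** A vector z orthogonal to R, u and u' exists since 3 + 2 < 6. The two bases are then joined by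
    plane moves fixing u, then z, then u'. *)
Lemma sigv_span u v w u' v' w' R : orth [:: u, v, w & R] -> orth [:: u', v', w' & R] ->
  size R = 3%N -> sigv u v w = sigv u' v' w'.
Proof.
move=> o o' sR.
have oR : orth R by move: o; rewrite !orth_cons => /and5P[_ _ _ _ /and3P[]].
have [|z oz] := exists_orth (X := [:: u; u']) oR; first by rewrite sR.
rewrite /= andbT => /andP[/eqP zu /eqP zu'].
have ext t : t != 0 -> bil z t = 0 -> perp t R -> exists s, orth [:: t, z, s & R].
  move=> t0 zt tR.
  have [||s os _] := exists_orth (L := [:: t, z & R]) (X := [::]).
  - by rewrite orth_cons t0 perp_cons bilC zt eqxx tR oz.
  - by rewrite /= sR.
  by exists s; orth_reorder os.
have [s os] : exists s, orth [:: u, z, s & R].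
  move: o; rewrite orth_cons !perp_cons => /and3P[u0 /and3P[_ _ uR] _]; exact: ext.
have [s' os'] : exists s', orth [:: u', z, s' & R].
  move: o'; rewrite orth_cons !perp_cons => /and3P[u0 /and3P[_ _ uR] _]; exact: ext.
rewrite (sigv_plane o os sR) (sigv_plane o' os' sR).
rewrite (sigv_rot os).1 (sigv_rot os').1; apply: (@sigv_plane _ _ _ _ _ R) => //.
- by orth_reorder os.
- by orth_reorder os'.
Qed.

End Signatures.

(** * Edges as rotations of frames *)

Section FrameEdges.
Variable F : fieldType.
Hypothesis F2 : 2%:R = 0 :> F.
Variable tau : K2mod2 F.
Implicit Types (p q r x y : F) (L R X : seq 'rV[F]_6).

(** The sum is unchanged because {al ga, x^2 + al ga} = 0 by [sy_norm]. *)
Lemma edge_step (al be ga de x : F) :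
  al != 0 -> be != 0 -> ga != 0 -> de != 0 -> x ^+ 2 + al * ga != 0 ->
  is_vertex tau (sy al be, sy ga de) ->
  edge tau (if x == 0 then typeI else typeII) (sy al be, sy ga de)
    (sy al ((x ^+ 2 + al * ga) * be), sy ga ((x ^+ 2 + al * ga) * de)).
Proof.
move=> al0 be0 ga0 de0 e0 vS; split=> //.
  split; [by do 2!eexists|by do 2!eexists|case: vS => _ _ /= <-].
  rewrite !syMr // addrACA -syMl // -[X in sy _ (_ + X)]mulr1 -(expr1n F 2).
  by rewrite sy_norm // add0r.
have e0' : x ^+ 2 + val (unit_of al) * val (unit_of ga) != 0 by rewrite !val_unit_of.
exists (unit_of al), (unit_of be), (unit_of ga), (unit_of de), x, e0'.
split=> //; first by case: eqP.
by rewrite !symbol2_sy /= !val_unit_of.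
Qed.

Lemma sig_edge q1 q2 q3 q4 q5 q6 q3' q4' s x y d :
  q1 != 0 -> q2 != 0 -> q3 != 0 -> q4 != 0 -> q5 != 0 -> q6 != 0 -> q3' != 0 -> q4' != 0 ->
  y != 0 -> q1 * q2 * q3 * q4 * q5 * q6 = s ^+ 2 ->
  q3' = x ^+ 2 * q3 + y ^+ 2 * q4 -> q3' * q4' = d ^+ 2 * (q3 * q4) ->
  is_vertex tau (sig q1 q2 q3, sig q5 q6 q4) ->
  edge tau (if x == 0 then typeI else typeII)
    (sig q1 q2 q3, sig q5 q6 q4) (sig q1 q2 q3', sig q5 q6 q4').
Proof.
move=> n1 n2 n3 n4 n5 n6 n3' n4' y0 sE q3E dE vS.
have s0 : s != 0.
  by apply: contraNneq (mulf_neq0 (mulf_neq0 (mulf_neq0 n1 n2) (mulf_neq0 n3 n4))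
    (mulf_neq0 n5 n6)) => s0; rewrite !mulrA sE s0 expr0n.
have d0 : d != 0.
  by apply: contraNneq (mulf_neq0 n3' n4') => d0; rewrite dE d0 expr0n mul0r.
(* With al = q1 q2 and ga = q5 q6, the determinant gives al ga = s^2 / (q3 q4). These values make
   X^2 + al ga equal to q3 q3' up to a square, the factor that turns q3 into q3' and q4 into q4'. *)
pose X := s * x / (q4 * y); pose E := s / (q4 * y * q3).
have XE : X ^+ 2 + q1 * q2 * (q5 * q6) = E ^+ 2 * (q3 * q3').
  have -> : q1 * q2 * (q5 * q6) = s ^+ 2 / (q3 * q4).
    by rewrite -sE; field; rewrite n3 n4.
  by rewrite /X /E q3E; field; rewrite n3 n4 y0.
have E0 : E != 0 by rewrite /E mulf_neq0 // invr_eq0 !mulf_neq0.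
have X0 : (X == 0) = (x == 0).
  by rewrite /X !mulf_eq0 invr_eq0 !mulf_eq0 (negbTE s0) (negbTE n4) (negbTE y0) !orbF.
have := @edge_step (q1 * q2) (q1 * q3) (q5 * q6) (q5 * q4) X.
have e0 : E ^+ 2 * (q3 * q3') != 0 by rewrite (mulf_neq0 _ (mulf_neq0 n3 n3')) ?sqrf_eq0.
rewrite X0 XE => /(_ (mulf_neq0 n1 n2) (mulf_neq0 n1 n3) (mulf_neq0 n5 n6) (mulf_neq0 n5 n4) e0 vS).
rewrite (_ : E ^+ 2 * (q3 * q3') * (q1 * q3) = (E * q3) ^+ 2 * (q1 * q3')); last by ring.
rewrite (_ : E ^+ 2 * (q3 * q3') * (q5 * q4) = (E * q3' / d) ^+ 2 * (q5 * q4')).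
  by rewrite !sy_sqrMr // ?(mulf_neq0 E0) // mulf_neq0 ?invr_eq0 // (mulf_neq0 E0).
have -> : q4' = d ^+ 2 * (q3 * q4) / q3' by rewrite -dE mulrAC mulfV ?mul1r.
by field; rewrite n3' d0.
Qed.

Variable g : 'I_6 -> F.
Hypothesis aniso : forall v, qf g v = 0 -> v = 0.
Hypothesis g_det : exists s, \prod_i g i = s ^+ 2.

Lemma orth_det L : orth g L -> size L = 6%N -> exists s, \prod_(v <- L) qf g v = s ^+ 2.
Proof.
move=> oL sL; pose M := \matrix_(i < 6) (nth 0 L i : 'rV[F]_6).
have [s sE] := g_det.
have e : M *m diag_mx (\row_i g i) *m M^T = diag_mx (\row_i qf g (nth 0 L i)).
  apply/matrixP => i j; rewrite !mxE.
  have -> : \sum_k (M *m diag_mx (\row_i0 g i0)) i k * M^T k j = bil g (nth 0 L i) (nth 0 L j).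
    apply: eq_bigr => k _; rewrite mul_mx_diag !mxE; ring.
  have [-> //|ij] := eqVneq i j; rewrite mulr0n.
  have /andP[/(pairwiseP 0) pw _] := oL.
  have [lij|lji|/val_inj eij] := ltngtP i j.
  - by apply/eqP/pw; rewrite ?inE ?sL.
  - by rewrite bilC; apply/eqP/pw; rewrite ?inE ?sL.
  - by rewrite eij eqxx in ij.
exists (\det M * s); rewrite (big_nth 0) sL big_mkord.
have := congr1 determinant e; rewrite !det_mulmx det_tr !det_diag.
rewrite (eq_bigr g); last by move=> i _; rewrite mxE.
rewrite sE => h; rewrite exprMn [_ ^+ 2 * _]mulrC expr2 mulrCA mulrA -expr2 mulrAC.
transitivity (\prod_(i < 6) (\row_i qf g (nth 0 L i)) 0 i).
  by apply: eq_bigr => i _; rewrite mxE.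
by rewrite -h; ring.
Qed.

Definition frame_vertex v1 v2 v3 v4 v5 v6 := (sigv g v1 v2 v3, sigv g v4 v5 v6).

Lemma frame_edge v1 v2 v3 v4 v5 v6 v3' v4' :
  orth g [:: v1; v2; v3; v4; v5; v6] -> orth g [:: v1; v2; v3'; v4'; v5; v6] ->
  is_vertex tau (frame_vertex v1 v2 v3 v4 v5 v6) ->
  (exists x, v3' = x *: v3 /\
    frame_vertex v1 v2 v3' v4' v5 v6 = frame_vertex v1 v2 v3 v4 v5 v6) \/
  exists x y, v3' = x *: v3 + y *: v4 /\
    edge tau (if x == 0 then typeI else typeII)
      (frame_vertex v1 v2 v3 v4 v5 v6) (frame_vertex v1 v2 v3' v4' v5 v6).
Proof.
move=> o o' vS.
have nz v : v \in [:: v1; v2; v3; v4; v5; v6] -> qf g v != 0.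
  by move=> vL; exact/(qf_neq0 aniso)/(orth_neq0 aniso o).
have nz' v : v \in [:: v1; v2; v3'; v4'; v5; v6] -> qf g v != 0.
  by move=> vL; exact/(qf_neq0 aniso)/(orth_neq0 aniso o').
have n1 : qf g v1 != 0 by apply: nz; rewrite !inE eqxx ?orbT.
have n2 : qf g v2 != 0 by apply: nz; rewrite !inE eqxx ?orbT.
have n3 : qf g v3 != 0 by apply: nz; rewrite !inE eqxx ?orbT.
have n4 : qf g v4 != 0 by apply: nz; rewrite !inE eqxx ?orbT.
have n5 : qf g v5 != 0 by apply: nz; rewrite !inE eqxx ?orbT.
have n6 : qf g v6 != 0 by apply: nz; rewrite !inE eqxx ?orbT.
have n3' : qf g v3' != 0 by apply: nz'; rewrite !inE eqxx ?orbT.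
have n4' : qf g v4' != 0 by apply: nz'; rewrite !inE eqxx ?orbT.
have p : orth g [:: v3; v4; v1; v2; v5; v6] by orth_reorder o.
have p' : orth g [:: v3'; v4'; v1; v2; v5; v6] by orth_reorder o'.
have [//|x [y [d [vE qE dE]]]] := plane_move F2 aniso p p'.
have S2 q : q != 0 -> sig q (qf g v5) (qf g v6) = sig (qf g v5) (qf g v6) q.
  by move=> q0; rewrite (sig_rot F2) // sigC.
rewrite /frame_vertex /sigv !S2 // in vS *.
(* [sig_edge] divides by y; if y = 0, then v3' is a multiple of v3 and the vertex does not move. *)
have [y0|y0] := eqVneq y 0.
  left; exists x; split; first by rewrite vE y0 scale0r addr0.
  rewrite y0 expr0n mul0r addr0 in qE.
  have x0 : x != 0 by apply: contraNneq n3' => x0; rewrite qE x0 expr0n mul0r.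
  have d0 : d != 0.
    by apply: contraNneq (mulf_neq0 n3' n4') => d0; rewrite dE d0 expr0n mul0r.
  have q4E : qf g v4' = (d / x) ^+ 2 * qf g v4.
    apply: (mulfI n3'); rewrite dE qE; field; exact: x0.
  rewrite /sig qE q4E ![_ * (_ ^+ 2 * _)]mulrCA !sy_sqrMr //.
  by rewrite mulf_neq0 ?invr_eq0.
right; exists x, y; split=> //.
have [//|s sE] := orth_det o.
rewrite !big_cons big_nil in sE.
apply: (@sig_edge _ _ _ _ _ _ _ _ s x y d) => //.
by rewrite -sE; ring.
Qed.

(** Here v3' = v4 is orthogonal to v3, so its coefficient on v3, which decides the type, is 0. *)
Lemma frame_swap v1 v2 v3 v4 v5 v6 :
  orth g [:: v1; v2; v3; v4; v5; v6] -> is_vertex tau (frame_vertex v1 v2 v3 v4 v5 v6) ->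
  edge tau typeI (frame_vertex v1 v2 v3 v4 v5 v6) (frame_vertex v1 v2 v4 v3 v5 v6).
Proof.
move=> o vS; have o' : orth g [:: v1; v2; v4; v3; v5; v6] by orth_reorder o.
have p : orth g [:: v3; v4; v1; v2; v5; v6] by orth_reorder o.
have v34 : bil g v3 v4 = 0 by move: p; rewrite orth_cons perp_cons => /and3P[_ /andP[/eqP]].
have nz v : v \in [:: v1; v2; v3; v4; v5; v6] -> qf g v != 0.
  by move=> vL; exact/(qf_neq0 aniso)/(orth_neq0 aniso o).
have n3 : qf g v3 != 0 by apply: nz; rewrite !inE eqxx ?orbT.
have n4 : v4 != 0 by apply: (orth_neq0 aniso o); rewrite !inE eqxx ?orbT.
have x0 x y : v4 = x *: v3 + y *: v4 -> x = 0.
  move=> e; apply: (mulIf n3); rewrite mul0r -[RHS]v34 e.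
  by rewrite bilDr !bilZr v34 mulr0 addr0.
have [[x [vE _]]|[x [y [/x0 -> ]]]] := frame_edge o o' vS; last by rewrite eqxx.
have x00 : x = 0 by apply: (x0 x 0); rewrite scale0r addr0.
by move: n4; rewrite vE x00 scale0r eqxx.
Qed.

(** The mixed frame encodes equality of spans: both first triples span the complement of v4, v5, v6,
    and both second triples that of w1, w2, w3. *)
Lemma frame_vertex_eq v1 v2 v3 v4 v5 v6 w1 w2 w3 w4 w5 w6 :
  orth g [:: v1; v2; v3; v4; v5; v6] -> orth g [:: w1; w2; w3; v4; v5; v6] ->
  orth g [:: w1; w2; w3; w4; w5; w6] ->
  frame_vertex v1 v2 v3 v4 v5 v6 = frame_vertex w1 w2 w3 w4 w5 w6.
Proof.
move=> o o' o''; rewrite /frame_vertex (sigv_span F2 aniso o o') //.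
have p' : orth g [:: v4; v5; v6; w1; w2; w3] by orth_reorder o'.
have p'' : orth g [:: w4; w5; w6; w1; w2; w3] by orth_reorder o''.
by rewrite (sigv_span F2 aniso p' p'').
Qed.

(** One exchange at each end leads to triples U and W sharing l and c. The gap between them is
    closed by a single rotation, or by two exchanges through Z. *)
Lemma frames_connected f1 f2 f3 f4 f5 f6 h1 h2 h3 h4 h5 h6 :
  orth g [:: f1; f2; f3; f4; f5; f6] -> orth g [:: h1; h2; h3; h4; h5; h6] ->
  is_vertex tau (frame_vertex f1 f2 f3 f4 f5 f6) ->
  exists U W Z : K2mod2 F * K2mod2 F,
   [/\ edge tau typeI (frame_vertex f1 f2 f3 f4 f5 f6) U,
       edge tau typeI W (frame_vertex h1 h2 h3 h4 h5 h6),
       W = U \/ exists t, edge tau t U W,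
       edge tau typeI U Z & edge tau typeI Z W].
Proof.
move=> oF oH vF.
have edgeV t v w : edge tau t v w -> is_vertex tau w by case.
have oR : orth g [:: f4; f5; f6].
  have : orth g [:: f1; f2; f3; f4; f5; f6] by [].
  by rewrite !orth_cons => /and5P[_ _ _ _ /and5P[_ _ -> -> ->]].
have oS : orth g [:: h4; h5; h6].
  have : orth g [:: h1; h2; h3; h4; h5; h6] by [].
  by rewrite !orth_cons => /and5P[_ _ _ _ /and5P[_ _ -> -> ->]].
(* The vectors l and c, one from each triple of the first frame, are both orthogonal to h5 and h6;
   the exchange of c with k3 puts them in one triple. *)
have [//|l ol /and3P[/eqP lh5 /eqP lh6 _]] := exists_orth (X := [:: h5; h6]) oR.
have [//|k2 ok2 _] := exists_orth (X := [::]) ol.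
have [//|k3 ok3 _] := exists_orth (X := [::]) ok2.
have oA : orth g [:: l; k2; k3; f4; f5; f6] by orth_reorder ok3.
have oA3 : orth g [:: l; k2; k3].
  have : orth g [:: f4; f5; f6; l; k2; k3] by orth_reorder ok3.
  by rewrite !orth_cons => /and5P[_ _ _ _ /and5P[_ _ -> -> ->]].
have [//|c oc /and3P[/eqP ch5 /eqP ch6 _]] := exists_orth (X := [:: h5; h6]) oA3.
have [//|k5 ok5 _] := exists_orth (X := [::]) oc.
have [//|k6 ok6 _] := exists_orth (X := [::]) ok5.
have oA' : orth g [:: l; k2; k3; c; k5; k6] by orth_reorder ok6.
have VA := frame_vertex_eq oF oA oA'.
have vA : is_vertex tau (frame_vertex l k2 k3 c k5 k6) by rewrite -VA.
have E1 := frame_swap oA' vA; rewrite -VA in E1.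
have oU : orth g [:: l; k2; c; k3; k5; k6] by orth_reorder oA'.
(* The vector m of the first h-triple is orthogonal to l and c. Once exchanged with h4, it leaves m,
   h5, h6 as second triple, so l and c lie in the span of the first. *)
have [//|m om /and3P[/eqP mc /eqP ml _]] := exists_orth (X := [:: c; l]) oS.
have [//|n1 on1 _] := exists_orth (X := [::]) om.
have [//|n2 on2 _] := exists_orth (X := [::]) on1.
have oB : orth g [:: n1; n2; m; h4; h5; h6] by orth_reorder on2.
have VB := frame_vertex_eq oH oB oB.
have oB' : orth g [:: n1; n2; h4; m; h5; h6] by orth_reorder oB.
have omh : orth g [:: m; h5; h6].
  have : orth g [:: n1; n2; h4; m; h5; h6] by [].
  by rewrite !orth_cons => /and5P[_ _ _ _ /and5P[_ _ -> -> ->]].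
have c0 : c != 0 by apply: (orth_neq0 aniso oA'); rewrite !inE eqxx ?orbT.
have l0 : l != 0 by apply: (orth_neq0 aniso oA'); rewrite !inE eqxx ?orbT.
have lc : bil g l c = 0.
  have : orth g [:: l; c; k2; k3; k5; k6] by orth_reorder oA'.
  by rewrite orth_cons perp_cons => /and3P[_ /andP[/eqP]].
have olc : orth g [:: l; c; m; h5; h6].
  rewrite !orth_cons l0 c0 !perp_cons lc ch5 ch6 lh5 lh6 bilC ml bilC mc !eqxx /=.
  by move: omh; rewrite !orth_cons.
have [//|h oh _] := exists_orth (X := [::]) olc.
have oW : orth g [:: l; c; h; m; h5; h6] by orth_reorder oh.
have VW := frame_vertex_eq oB' oW oW.
have oU' : orth g [:: l; c; k2; k3; k5; k6] by orth_reorder oA'.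
have olck : orth g [:: l; c; k2].
  have : orth g [:: k3; k5; k6; l; c; k2] by orth_reorder oU'.
  by rewrite !orth_cons => /and5P[_ _ _ _ /and5P[_ _ -> -> ->]].
(* t1 and t2 are orthogonal to l, c, k2 and h, hence lie in both second triples: only the plane of
   k2 and t has to turn into that of h and t'. *)
have [//|t1 ot1 /andP[/eqP t1h _]] := exists_orth (X := [:: h]) olck.
have [//|t2 ot2 /andP[/eqP t2h _]] := exists_orth (X := [:: h]) ot1.
have [//|t ot _] := exists_orth (X := [::]) ot2.
have oU1 : orth g [:: l; c; k2; t; t1; t2] by orth_reorder ot.
have oU2 : orth g [:: l; c; k2; t1; t; t2] by orth_reorder ot.
have VU : frame_vertex l k2 c k3 k5 k6 = frame_vertex l c k2 k3 k5 k6.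
  by rewrite /frame_vertex (sigv_rot F2 aniso oU).2.
have VU1 := frame_vertex_eq oU' oU' oU1.
have VU2 := frame_vertex_eq oU' oU' oU2.
have vU : is_vertex tau (frame_vertex l k2 c k3 k5 k6) := edgeV _ _ _ E1.
have h0 : h != 0 by apply: (orth_neq0 aniso oW); rewrite !inE eqxx ?orbT.
have hl : bil g h l = 0 /\ bil g h c = 0.
  have : orth g [:: h; l; c; m; h5; h6] by orth_reorder oW.
  by rewrite orth_cons !perp_cons => /and3P[_ /and3P[/eqP-> /eqP->]].
have opre : orth g [:: t1; t2; l; c].
  have : orth g [:: t; k2; t1; t2; l; c] by orth_reorder ot.
  by rewrite !orth_cons => /and5P[_ _ _ _ /and5P[-> -> -> -> /and3P[-> -> ->]]].
have oht : orth g [:: h; t1; t2; l; c].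
  by rewrite orth_cons h0 opre !perp_cons hl.1 hl.2 !(bilC g h) t1h t2h eqxx.
have [//|t' ot' _] := exists_orth (X := [::]) oht.
have oW1 : orth g [:: l; c; h; t'; t1; t2] by orth_reorder ot'.
have VW1 := frame_vertex_eq oW oW oW1.
(* As t1 is orthogonal to k2 and to h, the triple l, c, t1 is one exchange away from both U and
   W. *)
have ohlt : orth g [:: l; c; t1; h; t2; t'] by orth_reorder ot'.
have oZ : orth g [:: l; c; t1; k2; t; t2] by orth_reorder ot.
have VZ := frame_vertex_eq oZ oZ ohlt.
have oW2 : orth g [:: l; c; h; t1; t2; t'] by orth_reorder ot'.
have VW2 := frame_vertex_eq oW oW oW2.
have E3 : edge tau typeI (frame_vertex l k2 c k3 k5 k6) (frame_vertex l c t1 k2 t t2).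
  by rewrite VU VU2; apply: frame_swap => //; rewrite -VU2 -VU.
have E4 : edge tau typeI (frame_vertex l c t1 k2 t t2) (frame_vertex n1 n2 h4 m h5 h6).
  by rewrite VZ VW VW2; apply: frame_swap => //; rewrite -VZ; exact: edgeV E3.
have E2 := frame_swap oB' (edgeV _ _ _ E4); rewrite -VB in E2.
exists (frame_vertex l k2 c k3 k5 k6), (frame_vertex n1 n2 h4 m h5 h6).
exists (frame_vertex l c t1 k2 t t2); split=> //.
have [|[x [_ e]]|[x [y [_ e]]]] := frame_edge oU1 oW1.
- by rewrite -VU1 -VU.
- by left; rewrite VW VW1 e VU VU1.
- by right; eexists; rewrite VU VU1 VW VW1; exact: e.
Qed.

End FrameEdges.

Section AlbertForm.
Variable F : fieldType.
Hypothesis F2 : 2%:R = 0 :> F.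
Implicit Types (a b c d : F) (v w : 'rV[F]_6).

Definition albert_coef a b c d : 'I_6 -> F :=
  fun i => nth 0 [:: a; b; a * b; c; d; c * d] i.

Definition row6 (x1 x2 x3 x4 x5 x6 : F) : 'rV[F]_6 :=
  \row_i nth 0 [:: x1; x2; x3; x4; x5; x6] i.

Lemma bil_albert_row6 a b c d x1 x2 x3 x4 x5 x6 y1 y2 y3 y4 y5 y6 :
  bil (albert_coef a b c d) (row6 x1 x2 x3 x4 x5 x6) (row6 y1 y2 y3 y4 y5 y6) =
  a * x1 * y1 + b * x2 * y2 + a * b * x3 * y3
  + c * x4 * y4 + d * x5 * y5 + c * d * x6 * y6.
Proof.
by rewrite /bil !big_ord_recl big_ord0 !mxE /albert_coef /=; ring.
Qed.

Lemma row6_surj v : exists x1 x2 x3 x4 x5 x6, v = row6 x1 x2 x3 x4 x5 x6.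
Proof.
pose h k : F := v 0 (inord k).
exists (h 0%N), (h 1%N), (h 2%N), (h 3%N), (h 4%N), (h 5%N).
apply/rowP => i; rewrite mxE.
have -> : v 0 i = h i by rewrite /h inord_val.
by case: i => [[|[|[|[|[|[|]]]]]]].
Qed.

Lemma row6_eq0 x1 x2 x3 x4 x5 x6 :
  (row6 x1 x2 x3 x4 x5 x6 == 0) =
  [&& x1 == 0, x2 == 0, x3 == 0, x4 == 0, x5 == 0 & x6 == 0].
Proof.
apply/eqP/idP => [/rowP h|].
  have e k : (k < 6)%N -> nth 0 [:: x1; x2; x3; x4; x5; x6] k = 0.
    by move=> k6; have := h (Ordinal k6); rewrite !mxE.
  have := (e 0%N isT, e 1%N isT, e 2%N isT, e 3%N isT, e 4%N isT, e 5%N isT).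
  by move=> /= [[[[[-> ->] ->] ->] ->] ->]; rewrite eqxx.
move=> /and5P[/eqP-> /eqP-> /eqP-> /eqP-> /andP[/eqP-> /eqP->]].
by apply/rowP => i; rewrite !mxE; case: i => [[|[|[|[|[|[|]]]]]]].
Qed.

Lemma albert_aniso a b c d : ~ albert_isotropic squares a b c d ->
  forall v, qf (albert_coef a b c d) v = 0 -> v = 0.
Proof.
move=> niso v; have [x1 [x2 [x3 [x4 [x5 [x6 ->]]]]]] := row6_surj v.
rewrite /qf bil_albert_row6 => e; apply/eqP; rewrite row6_eq0; apply/negPn/negP => nz.
apply: niso; exists (x1 ^+ 2), (x2 ^+ 2), (x3 ^+ 2), (x4 ^+ 2), (x5 ^+ 2), (x6 ^+ 2).
split; try by split; eexists.
- by rewrite -[RHS]e; ring.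
- by rewrite !sqrf_eq0.
Qed.

Lemma albert_det a b c d : exists s, \prod_i albert_coef a b c d i = s ^+ 2.
Proof.
exists (a * b * c * d).
by rewrite !big_ord_recl big_ord0 /albert_coef /=; ring.
Qed.

Lemma albert_frame a b c d : a != 0 -> b != 0 -> c != 0 -> d != 0 ->
  exists f1 f2 f3 f4 f5 f6,
    orth (albert_coef a b c d) [:: f1; f2; f3; f4; f5; f6] /\
    frame_vertex (albert_coef a b c d) f1 f2 f3 f4 f5 f6 = (sy a b, sy c d).
Proof.
move=> a0 b0 c0 d0.
exists (row6 1 0 0 0 0 0), (row6 0 1 0 0 0 0), (row6 0 0 1 0 0 0),
  (row6 0 0 0 1 0 0), (row6 0 0 0 0 1 0), (row6 0 0 0 0 0 1); split.
  rewrite !orth_cons !perp_cons !bil_albert_row6 !row6_eq0 !eqxx oner_eq0 /=.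
  by rewrite !(mulr0, mul0r, addr0) !eqxx.
rewrite /frame_vertex /sigv /qf !bil_albert_row6 !(mulr0, mul0r, mulr1, addr0, add0r).
have e (p q : F) : p != 0 -> q != 0 -> sig p q (p * q) = sy p q.
  move=> p0 q0; by rewrite /sig mulrA -expr2 sy_sqrMr // syMl // (sy_aa F2 q) addr0.
by rewrite !e.
Qed.

End AlbertForm.

(** * All vertices come from frames of one Albert form *)

Section EdgeClosure.
Variable F : fieldType.
Hypothesis F2 : 2%:R = 0 :> F.
Variable g : 'I_6 -> F.
Hypothesis aniso : forall v, qf g v = 0 -> v = 0.
Hypothesis g_det : exists s, \prod_i g i = s ^+ 2.

(** The values of the pure part of {q1 q2, q1 q3} are q1 q2 q3 times those of <q1, q2, q3>. With u
    realizing al, comparing the square determinants of two frames leaves al = qf k1 qf k2 up to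
    squares. *)
Lemma frame_slot f1 f2 f3 f4 f5 f6 al be : al != 0 -> be != 0 ->
  orth g [:: f1; f2; f3; f4; f5; f6] -> sy al be = sigv g f1 f2 f3 -> sy al be != 0 ->
  exists k1 k2 u s, [/\ orth g [:: k1; k2; u; f4; f5; f6], s != 0
    & al = s ^+ 2 * (qf g k1 * qf g k2)].
Proof.
move=> al0 be0 o e nz.
have nzf v : v \in [:: f1; f2; f3; f4; f5; f6] -> qf g v != 0.
  by move=> vL; exact/(qf_neq0 aniso)/(orth_neq0 aniso o).
have q1 : qf g f1 != 0 by apply: nzf; rewrite !inE eqxx ?orbT.
have q2 : qf g f2 != 0 by apply: nzf; rewrite !inE eqxx ?orbT.
have q3 : qf g f3 != 0 by apply: nzf; rewrite !inE eqxx ?orbT.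
have q4 : qf g f4 != 0 by apply: nzf; rewrite !inE eqxx ?orbT.
have q5 : qf g f5 != 0 by apply: nzf; rewrite !inE eqxx ?orbT.
have q6 : qf g f6 != 0 by apply: nzf; rewrite !inE eqxx ?orbT.
have [x [y [z alE]]] := slot_pure F2 (mulf_neq0 q1 q2) (mulf_neq0 q1 q3) al0 be0 (esym e) nz.
have b12 : bil g f1 f2 = 0 by move: o; rewrite orth_cons !perp_cons => /and3P[_ /andP[/eqP->]].
have b13 : bil g f1 f3 = 0.
  by move: o; rewrite orth_cons !perp_cons => /and3P[_ /and3P[_ /eqP->]].
have b23 : bil g f2 f3 = 0.
  by move: o; rewrite !orth_cons !perp_cons => /and4P[_ _ _ /and3P[/andP[/eqP->]]].
pose u := (x / qf g f3) *: f3 + 1 *: ((y / qf g f2) *: f2 + z *: f1).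
have qu : al = qf g f1 * qf g f2 * qf g f3 * qf g u.
  rewrite alE /u qf_lin; last by rewrite bilDr !bilZr !(bilC _ f3) b13 b23; ring.
  rewrite qf_lin; last by rewrite bilC.
  by field; rewrite q2 q3.
have u0 : u != 0.
  by apply: contraNneq al0 => u0; rewrite qu u0 /qf bil0l mulr0.
have pu : perp g u [:: f4; f5; f6].
  apply/perpP => t tL; rewrite /u !(bilDl, bilZl).
  have z0 v : v \in [:: f1; f2; f3] -> bil g v t = 0.
    by move=> vL; apply: (@orth_cross _ g [:: f1; f2; f3] [:: f4; f5; f6]).
  by rewrite !z0 ?inE ?eqxx ?orbT //; ring.
have oR : orth g [:: f4; f5; f6].
  by move: o; rewrite !orth_cons => /and5P[_ _ _ _ /and5P[_ _ -> -> ->]].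
have ou : orth g [:: u; f4; f5; f6] by rewrite orth_cons u0 pu.
have [//|k1 ok1 _] := exists_orth (X := [::]) ou.
have [//|k2 ok2 _] := exists_orth (X := [::]) ok1.
have o' : orth g [:: k1; k2; u; f4; f5; f6] by orth_reorder ok2.
have [//|s sE] := orth_det g_det o.
have [//|s' sE'] := orth_det g_det o'.
rewrite !big_cons big_nil mulr1 in sE sE'.
have nzf' v : v \in [:: k1; k2; u; f4; f5; f6] -> qf g v != 0.
  by move=> vL; exact/(qf_neq0 aniso)/(orth_neq0 aniso o').
have qk1 : qf g k1 != 0 by apply: nzf'; rewrite !inE eqxx ?orbT.
have qk2 : qf g k2 != 0 by apply: nzf'; rewrite !inE eqxx ?orbT.
have qu0 : qf g u != 0 by apply: nzf'; rewrite !inE eqxx ?orbT.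
have s0 : s != 0 by rewrite -sqrf_eq0 -sE !mulf_neq0.
have s'0 : s' != 0 by rewrite -sqrf_eq0 -sE' !mulf_neq0.
exists k1, k2, u, (s / s' * qf g u); split=> //.
  by rewrite !mulf_neq0 ?invr_eq0.
rewrite qu exprMn expr_div_n -sE -sE'; field.
by rewrite q4 q5 q6 qk1 qk2 qu0.
Qed.

Definition in_frames (v : K2mod2 F * K2mod2 F) : Prop :=
  exists f1 f2 f3 f4 f5 f6, orth g [:: f1; f2; f3; f4; f5; f6] /\
    v = frame_vertex g f1 f2 f3 f4 f5 f6.

Lemma vertex_fst_eq (tau : K2mod2 F) (v w : K2mod2 F * K2mod2 F) :
  is_vertex tau v -> is_vertex tau w -> v.1 = w.1 -> v = w.
Proof.
case: v w => [v1 v2] [w1 w2] [_ _ /= ev] [_ _ /= ew] /= e.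
by move: ev; rewrite -ew e => /addrI ->.
Qed.

Lemma vertex_neq0 (tau : K2mod2 F) (a b c d : F) : ~ is_symbol2 tau -> is_vertex tau (sy a b, sy c d) ->
  sy a b != 0 /\ sy c d != 0.
Proof.
move=> ntau [_ _ /= e]; split; apply/eqP => e0; apply: ntau; rewrite -e e0 ?add0r ?addr0.
- by exists (unit_of c), (unit_of d).
- by exists (unit_of a), (unit_of b).
Qed.

(** A frame is adapted to the slots al and ga by [frame_slot] on both triples. Then x^2 + al ga is
    qf u times a value on the plane of u and u', so the edge rotates this plane; second symbols
    agree because both pairs sum to tau. *)
Lemma edge_in_frames (tau : K2mod2 F) t v w : ~ is_symbol2 tau ->
  in_frames v -> edge tau t v w -> in_frames w.
Proof.
move=> ntau [f1 [f2 [f3 [f4 [f5 [f6 [o vE]]]]]]] [vv vw].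
move=> [al [be [ga [de [x [e0 [_ vE' wE]]]]]]].
have nzu (z : units F) : val z != 0 by exact: (valP z).
move: (nzu al) (nzu be) (nzu ga) (nzu de) => al0 be0 ga0 de0.
rewrite !symbol2_sy /= in vE' wE.
set A := sval al in al0 e0 vE' wE *; set C := sval ga in ga0 e0 vE' wE *.
set B := sval be in be0 vE' wE *; set E := sval de in de0 vE' wE *.
have [S1nz S2nz] : sy A B != 0 /\ sy C E != 0.
  by apply: (@vertex_neq0 tau) => //; rewrite -vE'.
have [S1E S2E] : sy A B = sigv g f1 f2 f3 /\ sy C E = sigv g f4 f5 f6.
  by move: vE'; rewrite vE => -[-> ->].
have [k1 [k2 [u [s [ok s0 AE]]]]] := frame_slot al0 be0 o S1E S1nz.
have {}AE : A = s ^+ 2 * (qf g k1 * qf g k2) := AE.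
have ok' : orth g [:: f4; f5; f6; k1; k2; u] by orth_reorder ok.
have [m1 [m2 [u' [s' [om s'0 CE]]]]] := frame_slot ga0 de0 ok' S2E S2nz.
have {}CE : C = s' ^+ 2 * (qf g m1 * qf g m2) := CE.
have o2 : orth g [:: k1; k2; u; u'; m1; m2] by orth_reorder om.
have v2 : v = frame_vertex g k1 k2 u u' m1 m2.
  by rewrite vE; exact: frame_vertex_eq o ok o2.
have nz z : z \in [:: k1; k2; u; u'; m1; m2] -> qf g z != 0.
  by move=> zL; exact/(qf_neq0 aniso)/(orth_neq0 aniso o2).
have q1 : qf g k1 != 0 by apply: nz; rewrite !inE eqxx ?orbT.
have q2 : qf g k2 != 0 by apply: nz; rewrite !inE eqxx ?orbT.
have q3 : qf g u != 0 by apply: nz; rewrite !inE eqxx ?orbT.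
have q4 : qf g u' != 0 by apply: nz; rewrite !inE eqxx ?orbT.
have [//|r rE] := orth_det g_det o2.
rewrite !big_cons big_nil mulr1 in rE.
(* The coefficients are read off from x^2 + A C, where A C is (s s' r)^2 / (qf u qf u') by the
   determinant. *)
pose w3 := (x / qf g u) *: u + (s * s' * r / (qf g u * qf g u')) *: u'.
have uu' : bil g u u' = 0.
  by apply: (@orth_cross _ g [:: k1; k2; u] [:: u'; m1; m2]); rewrite ?inE ?eqxx ?orbT.
have w3E : x ^+ 2 + A * C = qf g u * qf g w3.
  rewrite AE CE /w3 qf_lin // [(_ * r / _) ^+ 2]expr_div_n [(_ * r) ^+ 2]exprMn -rE; field.
  by rewrite q3 q4.
have qw3 : qf g w3 != 0.
  by apply: contraNneq e0 => h; rewrite w3E h mulr0.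
have w30 : w3 != 0 by apply: contraNneq qw3 => ->; rewrite /qf bil0l.
have okm : orth g [:: k1; k2; m1; m2].
  have : orth g [:: u; u'; k1; k2; m1; m2] by orth_reorder o2.
  by rewrite orth_cons => /and3P[_ _]; rewrite orth_cons => /and3P[_ _].
have ow3 : orth g [:: w3; k1; k2; m1; m2].
  rewrite orth_cons w30 okm andbT; apply/perpP => z zL.
  have oc : orth g ([:: u; u'] ++ [:: k1; k2; m1; m2]) by orth_reorder o2.
  have -> : bil g w3 z = x / qf g u * bil g u z + s * s' * r / (qf g u * qf g u') * bil g u' z.
    by rewrite /w3 bilDl !bilZl.
  rewrite (orth_cross oc _ zL) ?inE ?eqxx // (orth_cross oc _ zL) ?inE ?eqxx ?orbT //.
  by ring.
have [//|w4 ow4 _] := exists_orth (X := [::]) ow3.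
have o3 : orth g [:: k1; k2; w3; w4; m1; m2] by orth_reorder ow4.
have vN : is_vertex tau (frame_vertex g k1 k2 w3 w4 m1 m2).
  rewrite v2 in vv.
  have [[z [_ ->]] //|[z [t' [_ []]]]//] := frame_edge F2 aniso g_det o2 o3 vv.
exists k1, k2, w3, w4, m1, m2; split=> //.
apply: (vertex_fst_eq vw vN); rewrite wE /= w3E.
have -> : sy A (qf g u * qf g w3 * B) = sy A (qf g u * qf g w3) + sy A B.
  by rewrite syMr ?mulf_neq0.
rewrite S1E; rewrite (sigv_span F2 aniso o ok) //.
rewrite AE sy_sqrMl // /sigv /sig -syMr ?mulf_neq0 //.
rewrite (_ : _ * _ * (_ * _) = (qf g u) ^+ 2 * (qf g k1 * qf g w3)) ?sy_sqrMr //.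
by ring.
Qed.

End EdgeClosure.

(** * Vertices sharing a slot, and the field generated by the slots *)

Section CommonSlot.
Variable F : fieldType.
Hypothesis F2 : 2%:R = 0 :> F.
Variable tau : K2mod2 F.
Implicit Types (a b c d x y z : F).

Lemma sy_is_symbol2 a b : is_symbol2 (sy a b).
Proof. by exists (unit_of a), (unit_of b). Qed.

Lemma vertex_sy (v : K2mod2 F * K2mod2 F) : is_vertex tau v ->
  exists a b c d, [/\ a != 0, b != 0, c != 0 & d != 0] /\ v = (sy a b, sy c d).
Proof.
case: v => [_ _] [[a [b /= ->]] [c [d /= ->]] _].
exists (val a), (val b), (val c), (val d); rewrite !symbol2_sy; split=> //.
by split; [exact: (valP a)|exact: (valP b)|exact: (valP c)|exact: (valP d)].
Qed.

Lemma edge_sym t v w : edge tau t v w -> edge tau t w v.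
Proof.
move=> [vv vw [al [be [ga [de [x [e0 [tE vE wE]]]]]]]]; split=> //.
exists al, (umul (mkunit e0) be), ga, (umul (mkunit e0) de), x, e0; split=> //.
rewrite vE !symbol2_sy /= !mulrA -!expr2 !sy_sqrMr //.
Qed.

Section NotSymbol.
Hypothesis ntau : ~ is_symbol2 tau.

Lemma vertex_not_isotropic a b c d : a != 0 -> b != 0 -> c != 0 -> d != 0 ->
  is_vertex tau (sy a b, sy c d) -> ~ albert_isotropic squares a b c d.
Proof.
move=> a0 b0 c0 d0 [_ _ /= e] /(albert_isotropic_linked F2 a0 b0 c0 d0).
move=> [p [q [r [p0 q0 r0 e1 e2]]]]; apply: ntau.
by rewrite -e e1 e2 -syMr //; exact: sy_is_symbol2.
Qed.

(** The second symbols differ by {al, b b'}, so they share a slot p, which is itself a slot of {al,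
    b b'}. Writing p = x^2 al + w with {al, w} = {al, b b'} yields the edge. *)
Lemma common_slot_edge (al b c d b' c' d' : F) : al != 0 -> b != 0 -> c != 0 -> d != 0 ->
  b' != 0 -> c' != 0 -> d' != 0 ->
  is_vertex tau (sy al b, sy c d) -> is_vertex tau (sy al b', sy c' d') ->
  (sy al b, sy c d) = (sy al b', sy c' d') \/
  exists t, edge tau t (sy al b, sy c d) (sy al b', sy c' d').
Proof.
move=> al0 b0 c0 d0 b0' c0' d0' vS vT.
have [_ _ /= eS] := vS; have [_ _ /= eT] := vT.
have m0 : b * b' != 0 by rewrite mulf_neq0.
have e : sy c d + sy c' d' = sy al (b * b').
  rewrite syMr //; apply: (K2mod2_add_eq0); rewrite addrC addrACA eS eT.
  exact: K2mod2_addxx.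
have [p [q [r [p0 q0 r0 cE c'E]]]] := albert_isotropic_linked F2 c0 d0 c0' d0'
  (sum_symbol_isotropic F2 c0 d0 c0' d0' al0 m0 e).
rewrite cE in vS eS *; rewrite c'E in vT eT *.
have {}e : sy p (q * r) = sy al (b * b') by rewrite -e cE c'E syMr.
have [e0|e0] := eqVneq (sy al (b * b')) 0.
  left; apply: (vertex_fst_eq vS vT); apply: K2mod2_add_eq0.
  by rewrite /= -syMr.
right; have e0' : sy p (q * r) != 0 by rewrite e.
have [x [y [z pE]]] := slot_pure F2 al0 m0 p0 (mulf_neq0 q0 r0) (esym e) e0'.
pose w := b * b' * (y ^+ 2 + al * z ^+ 2).
have {}pE : p = x ^+ 2 * al + w by rewrite pE /w; ring.
have w0 : w != 0.
  (* If w = 0, then p is al up to a square, both symbols have the slot al, and tau is a symbol. *)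
  apply/eqP => w0; apply: ntau; rewrite w0 addr0 in pE.
  have x0 : x != 0 by apply: contraNneq p0 => x0; rewrite pE x0 expr0n mul0r.
  by rewrite -eS pE sy_sqrMl // -syMr //; exact: sy_is_symbol2.
have alw : sy al w = sy al (b * b') by exact: sy_mul_norm.
(* The element x al is chosen so that the edge factor becomes al w. *)
have nE : (x * al) ^+ 2 + al * p = al * w by rewrite pE; ring2 F2.
have n0 : (x * al) ^+ 2 + al * p != 0 by rewrite nE mulf_neq0.
have nal : sy al (al * w) = sy al (b * b') by rewrite syMr // sy_aa // add0r.
have np : sy p (al * w) = sy al (b * b').
  rewrite -alw pE; have [->|x0] := eqVneq x 0.
    by rewrite expr0n mul0r add0r syMr // sy_aa // addr0 syC.
  have xa0 : x ^+ 2 * al != 0 by rewrite mulf_neq0 ?sqrf_eq0.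
  rewrite -(sy_sqrMl F2 al w x0) -(sy_addM F2 xa0 w0) -?pE //.
  by rewrite -mulrA sy_sqrMr.
have -> : (sy al b', sy p r) = (sy al (((x * al) ^+ 2 + al * p) * b), sy p (((x * al) ^+ 2 + al * p) * q)).
  rewrite !syMr // nE nal np; congr pair; first by rewrite syMr // addrAC K2mod2_addxx add0r.
  by rewrite -e syMr // addrAC K2mod2_addxx add0r.
by eexists; exact: edge_step.
Qed.

(** On derivations killing a' the term dlog a' /\ dlog b' vanishes, so the Albert form is isotropic
    over F^2(a'). Separating its coefficients s_i^2 + t_i^2 a' makes a' a quotient of two values. *)
Lemma slot_scaling a b c d a' b' c' d' :
  [/\ a != 0, b != 0, c != 0 & d != 0] -> [/\ a' != 0, b' != 0, c' != 0 & d' != 0] ->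
  ~ albert_isotropic squares a b c d -> sy a b + sy c d = sy a' b' + sy c' d' ->
  exists s t, [/\ s != 0, t != 0 &
    qf (albert_coef a b c d) s = a' * qf (albert_coef a b c d) t].
Proof.
move=> [a0 b0 c0 d0] [a0' b0' c0' d0'] niso e.
have sq := square_subring_squares F2.
have iso : albert_isotropic (adj squares a') a b c d.
  apply: (albert_isotropic_same_form F2 (adj_square_subring sq a') a0 b0 c0 d0 c0' d0').
  move=> D D' dD dD' Dk Dk'; rewrite (wedge_sy_eq2 F2 dD dD' a0 b0 c0 d0 a0' b0' c0' d0' e).
  by rewrite {1}/wedge (dlog0 (Dk _ (adj_gen sq a'))) (dlog0 (Dk' _ (adj_gen sq a'))); ring.
case: iso => [r1 [r2 [r3 [r4 [r5 [r6 [[k1 k2 k3] [k4 k5 k6] iso nz]]]]]]].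
have [_ [_ [[s1 ->] [t1 ->] E1]]] := k1.
have [_ [_ [[s2 ->] [t2 ->] E2]]] := k2.
have [_ [_ [[s3 ->] [t3 ->] E3]]] := k3.
have [_ [_ [[s4 ->] [t4 ->] E4]]] := k4.
have [_ [_ [[s5 ->] [t5 ->] E5]]] := k5.
have [_ [_ [[s6 ->] [t6 ->] E6]]] := k6.
rewrite {}E1 {}E2 {}E3 {}E4 {}E5 {}E6 in iso nz.
pose s := row6 s1 s2 s3 s4 s5 s6; pose t := row6 t1 t2 t3 t4 t5 t6.
have qst : qf (albert_coef a b c d) s = a' * qf (albert_coef a b c d) t.
  by apply: (addF_eq0 F2); rewrite /qf !bil_albert_row6 -[RHS]iso; ring.
have aniso := albert_aniso niso.
have st : (s == 0) && (t == 0) = false.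
  apply/negbTE; apply: contra nz; rewrite !row6_eq0.
  move=> /andP[/and5P[/eqP-> /eqP-> /eqP-> /eqP-> /andP[/eqP-> /eqP->]]].
  move=> /and5P[/eqP-> /eqP-> /eqP-> /eqP-> /andP[/eqP-> /eqP->]].
  by rewrite !expr0n !mul0r !addr0 eqxx.
have q0 : qf (albert_coef a b c d) 0 = 0 by rewrite /qf bil0l.
exists s, t; split=> //; apply/eqP => h.
- move: qst st; rewrite h q0 eqxx /= => /esym/eqP; rewrite mulf_eq0 (negbTE a0') /=.
  by move=> /eqP/aniso ->; rewrite eqxx.
- by move: qst st; rewrite h q0 mulr0 eqxx andbT => /aniso ->; rewrite eqxx.
Qed.

Definition adj3 x y z : F -> Prop := adj (adj (adj squares x) y) z.

Lemma adj3_square_subring x y z : square_subring (adj3 x y z).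
Proof. by do 3!apply: adj_square_subring; exact: square_subring_squares. Qed.

Lemma qf_albert_in k a b c d v : square_subring k -> k a -> k b -> k c -> k d ->
  k (qf (albert_coef a b c d) v).
Proof.
move=> k_sub ka kb kc kd; have [x1 [x2 [x3 [x4 [x5 [x6 ->]]]]]] := row6_surj v.
rewrite /qf bil_albert_row6.
have m g x : k g -> k (g * x * x).
  by move=> kg; rewrite -mulrA -expr2; ssr_closed.
by do 5?[apply: ssrD => //]; apply: m; ssr_closed.
Qed.

Lemma slot_in_field k a b c d a' b' c' d' : square_subring k ->
  [/\ a != 0, b != 0, c != 0 & d != 0] -> [/\ a' != 0, b' != 0, c' != 0 & d' != 0] ->
  ~ albert_isotropic squares a b c d -> sy a b + sy c d = sy a' b' + sy c' d' ->
  k a -> k b -> k c -> k d -> k a'.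
Proof.
move=> k_sub n n' niso e ka kb kc kd.
have [s [t [s0 t0 st]]] := slot_scaling n n' niso e.
have q0 := qf_neq0 (albert_aniso niso) t0.
have -> : a' = qf (albert_coef a b c d) s * (qf (albert_coef a b c d) t)^-1.
  by rewrite st mulfK.
by apply: ssrM => //; [|apply: ssrV => //]; exact: qf_albert_in.
Qed.

(** The symmetries of a sum of two symbols bring each slot to the first place, where [slot_in_field]
    applies. *)
Lemma slots_in_field k a b c d a' b' c' d' : square_subring k ->
  [/\ a != 0, b != 0, c != 0 & d != 0] -> [/\ a' != 0, b' != 0, c' != 0 & d' != 0] ->
  ~ albert_isotropic squares a b c d -> sy a b + sy c d = sy a' b' + sy c' d' ->
  k a -> k b -> k c -> k d -> [/\ k a', k b', k c' & k d'].
Proof.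
move=> k_sub n [a0' b0' c0' d0'] niso e ka kb kc kd.
have e2 : sy a b + sy c d = sy b' a' + sy c' d' by rewrite e (syC F2 a').
have e3 : sy a b + sy c d = sy c' d' + sy a' b' by rewrite e addrC.
have e4 : sy a b + sy c d = sy d' c' + sy a' b' by rewrite e3 (syC F2 c').
split.
- exact: (slot_in_field k_sub n (And4 a0' b0' c0' d0') niso e).
- exact: (slot_in_field k_sub n (And4 b0' a0' c0' d0') niso e2).
- exact: (slot_in_field k_sub n (And4 c0' d0' a0' b0') niso e3).
- exact: (slot_in_field k_sub n (And4 d0' c0' a0' b0') niso e4).
Qed.

(* Vanishing on x, y, z is three linear equations for the coefficients of a
   combination of the four dual derivations. *)
Lemma not_free4_adj3 x y z a b c d : free squares [:: a; b; c; d] ->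
  a != 0 -> b != 0 -> c != 0 -> d != 0 ->
  adj3 x y z a -> adj3 x y z b -> adj3 x y z c -> adj3 x y z d -> False.
Proof.
move=> f a0 b0 c0 d0 ka kb kc kd; have sq := square_subring_squares F2.
have [D1 [d1 _ k1 e1 z1]] := free_dual F2 sq f.
have [D2 [d2 _ k2 e2 z2]] := free_dual F2 sq (free_swap F2 sq f).
have f3 := free_swap2 F2 sq f.
have [D3 [d3 _ k3 e3 z3]] := free_dual F2 sq (free_swap F2 sq f3).
have f4 := free_swap2 F2 sq (free_swap3 F2 sq f).
have [D4 [d4 _ k4 e4 z4]] := free_dual F2 sq (free_swap F2 sq f4).
pose Ds (i : nat) := nth D1 [:: D1; D2; D3; D4] i.
pose A := \matrix_(i < 4, j < 3) Ds i (nth x [:: x; y; z] j).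
have [//|v v0 vA] := exists_kernel A.
pose E t := \sum_i v 0 i * Ds i t.
have dDs (i : 'I_4) : derivation (Ds i) by case: i => [[|[|[|[|]]]]].
have kDs (i : 'I_4) : kills (Ds i) squares by case: i => [[|[|[|[|]]]]].
have dE : derivation E.
  split=> p q; rewrite /E.
    by rewrite -big_split; apply: eq_bigr => i _ /=; rewrite (derD (dDs i)) mulrDr.
  rewrite mulr_suml mulr_sumr -big_split; apply: eq_bigr => i _ /=.
  by rewrite (derM (dDs i)); ring.
have Exyz (j : 'I_3) : E (nth x [:: x; y; z] j) = 0.
  have := congr1 (fun m : 'rV_3 => m 0 j) vA; rewrite !mxE => <-.
  by apply: eq_bigr => i _; rewrite mxE.
have Ek : kills E (adj3 x y z).
  apply: kills_adj => //; last exact: (Exyz (Ordinal (isT : (2 < 3)%N))).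
  apply: kills_adj => //; last exact: (Exyz (Ordinal (isT : (1 < 3)%N))).
  apply: kills_adj => //; last exact: (Exyz (Ordinal (isT : (0 < 3)%N))).
  exact: kills_squares.
have EE t : E t = v 0 (inord 0) * D1 t + v 0 (inord 1) * D2 t
    + v 0 (inord 2) * D3 t + v 0 (inord 3) * D4 t.
  rewrite /E !big_ord_recl big_ord0 addr0 !addrA /Ds /=.
  by do !congr (_ + _); congr (v 0 _ * _); apply: val_inj; rewrite /= inordK.
have := Ek _ ka; rewrite EE e1 (z2 a) ?(z3 a) ?(z4 a) ?inE ?eqxx ?orbT // !mulr0 !addr0 => /eqP.
rewrite mulf_eq0 (negbTE a0) orbF => /eqP v1.
have := Ek _ kb; rewrite EE e2 (z1 b) ?(z3 b) ?(z4 b) ?inE ?eqxx ?orbT // !mulr0 !addr0 add0r => /eqP.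
rewrite mulf_eq0 (negbTE b0) orbF => /eqP v2.
have := Ek _ kc; rewrite EE e3 (z1 c) ?(z2 c) ?(z4 c) ?inE ?eqxx ?orbT // !mulr0 !addr0 !add0r => /eqP.
rewrite mulf_eq0 (negbTE c0) orbF => /eqP v3.
have := Ek _ kd; rewrite EE e4 (z1 d) ?(z2 d) ?(z3 d) ?inE ?eqxx ?orbT // !mulr0 !addr0 !add0r => /eqP.
rewrite mulf_eq0 (negbTE d0) orbF => /eqP v4.
case/eqP: v0; apply/rowP => i; rewrite mxE -(inord_val i).
by case: i => [[|[|[|[|]]]]].
Qed.

Lemma not_free4 a b c d : free squares [:: a; b] -> ~ free squares [:: a; b; c; d] ->
  exists x y z, [/\ adj3 x y z a, adj3 x y z b, adj3 x y z c & adj3 x y z d].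
Proof.
move=> [na [nb _]] nf; have sq := square_subring_squares F2.
have ab_sub := adj2_square_subring a b sq.
have k3 t : [/\ adj3 a b t a, adj3 a b t b & adj3 a b t t].
  split; last exact: adj_gen.
  - apply: adj_in => //; apply: adj_in; [exact: adj_square_subring|exact: adj_gen].
  - by apply: adj_in => //; apply: adj_gen; exact: adj_square_subring.
have [kc|nc] := pselect (adj (adj squares a) b c).
  by exists a, b, d; have [? ? ?] := k3 d; split=> //; exact: adj_in.
exists a, b, c; have [? ? ?] := k3 c; split=> //; apply: contrapT => nd.
by apply: nf.
Qed.

End NotSymbol.
End CommonSlot.

(** * Frames of two Albert forms with a common slot *)

Section Matching.
Variable F : fieldType.
Hypothesis F2 : 2%:R = 0 :> F.
Implicit Types (a b c d x y z : F).

Lemma sum_sqrF (I : finType) (f : I -> F) : (\sum_i f i) ^+ 2 = \sum_i f i ^+ 2.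
Proof.
by apply: (big_morph (fun t => t ^+ 2)) => [p q|]; [ring2 F2|rewrite expr0n].
Qed.

Lemma adj3_coef x y z t : adj3 x y z t -> exists c : 'I_8 -> F,
  t = \sum_j c j ^+ 2 * nth 0 [:: 1; x; y; x * y; z; x * z; y * z; x * y * z] j.
Proof.
move=> [_ [_ [[_ [_ [[_ [_ [[c0 ->] [c1 ->] ->]]] [_ [_ [[c2 ->] [c3 ->] ->]]] ->]]]
  [_ [_ [[_ [_ [[c4 ->] [c5 ->] ->]]] [_ [_ [[c6 ->] [c7 ->] ->]]] ->]]] ->]]].
exists (fun j => nth 0 [:: c0; c1; c2; c3; c4; c5; c6; c7] j).
by rewrite !big_ord_recl big_ord0 /=; ring.
Qed.

(** In characteristic 2 a sum of squares is the square of one linear form, so equality of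
    coordinates on the eight monomials becomes linear in v. *)
Lemma qf_adj3 (g : 'I_6 -> F) x y z : (forall i, adj3 x y z (g i)) ->
  exists C : 'M[F]_(6, 8), forall v, qf g v = \sum_j ((v *m C) 0 j) ^+ 2 *
    nth 0 [:: 1; x; y; x * y; z; x * z; y * z; x * y * z] j.
Proof.
move=> gK; have [c cE] := choice (fun i => adj3_coef (gK i)).
exists (\matrix_(i, j) c i j) => v; rewrite /qf /bil.
under eq_bigr => i _ do rewrite {1}cE 2!mulr_suml.
rewrite exchange_big; apply: eq_bigr => j _ /=.
rewrite mxE sum_sqrF mulr_suml; apply: eq_bigr => i _; rewrite mxE; ring.
Qed.

Lemma albert_coef_in k a b c d : square_subring k -> k a -> k b -> k c -> k d ->
  forall i, k (albert_coef a b c d i).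
Proof.
move=> k_sub ka kb kc kd; rewrite /albert_coef.
by case=> [[|[|[|[|[|[|]]]]]]] //= _; ssr_closed.
Qed.

(* Pairs of vectors with equal values in the 8-dimensional F^2(x, y, z) form a
   space of dimension at least 6 + 6 - 8 > 2, so two orthogonality conditions
   leave a nonzero pair. *)
Lemma common_pair (g g' : 'I_6 -> F) x y z :
  (forall v, qf g v = 0 -> v = 0) -> (forall v, qf g' v = 0 -> v = 0) ->
  (forall i, adj3 x y z (g i)) -> (forall i, adj3 x y z (g' i)) ->
  exists s0 s1 t0 t1, [/\ orth g [:: s0; s1], orth g' [:: t0; t1],
    qf g s0 = qf g' t0 & qf g s1 = qf g' t1].
Proof.
move=> an an' /qf_adj3[C CE] /qf_adj3[C' CE'].
have q0 : qf g 0 = 0 by rewrite /qf bil0l.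
have q0' : qf g' 0 = 0 by rewrite /qf bil0l.
have same (v : 'rV[F]_(6 + 6)) : v != 0 -> v *m col_mx C C' = 0 ->
    [/\ lsubmx v != 0, rsubmx v != 0 & qf g (lsubmx v) = qf g' (rsubmx v)].
  move=> v0; rewrite -{1}[v]hsubmxK mul_row_col => /rowP e.
  have qE : qf g (lsubmx v) = qf g' (rsubmx v).
    rewrite CE CE'; apply: eq_bigr => j _; congr (_ ^+ 2 * _).
    by apply: (addF_eq0 F2); have := e j; rewrite !mxE.
  split=> //; apply: contraNneq v0 => h; move: qE; rewrite h ?q0 ?q0'.
  - by move=> /esym/an' h'; rewrite -[v]hsubmxK h h' row_mx0.
  - by move=> /an h'; rewrite -[v]hsubmxK h h' row_mx0.
have [//|v v0 /(same v v0)[]] := exists_kernel (col_mx C C').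
set s0 := lsubmx v; set t0 := rsubmx v => s00 t00 q00.
pose bcol (h : 'I_6 -> F) (u : 'rV[F]_6) : 'cV[F]_6 := \col_i (h i * u 0 i).
have bcolE h u (w : 'rV[F]_6) : (w *m bcol h u) 0 0 = bil h u w.
  by rewrite mxE; apply: eq_bigr => i _; rewrite mxE; ring.
(* The two extra columns impose orthogonality to s0 and to t0; 8 + 2 equations are fewer than 12
   unknowns. *)
have [//|w w0] := exists_kernel (row_mx (col_mx C C')
   (row_mx (col_mx (bcol g s0) 0) (col_mx 0 (bcol g' t0)))).
rewrite !mul_mx_row => /eqP; rewrite !row_mx_eq0 => /and3P[/eqP/(same w w0)[]].
set s1 := lsubmx w; set t1 := rsubmx w => s10 t10 q11.
rewrite -[w]hsubmxK !mul_row_col !mulmx0 addr0 add0r -/s1 -/t1 => /eqP/matrixP es /eqP/matrixP et.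
exists s0, s1, t0, t1; split=> //.
- by rewrite !orth_cons s00 s10 perp_cons -bcolE es mxE eqxx.
- by rewrite !orth_cons t00 t10 perp_cons -bcolE et mxE eqxx.
Qed.

Lemma complete2 (g : 'I_6 -> F) v1 v2 : orth g [:: v1; v2] ->
  exists v3 v4 v5 v6, orth g [:: v3; v4; v5; v6; v1; v2].
Proof.
move=> o; have [//|v3 o3 _] := exists_orth (X := [::]) o.
have [//|v4 o4 _] := exists_orth (X := [::]) o3.
have [//|v5 o5 _] := exists_orth (X := [::]) o4.
have [//|v6 o6 _] := exists_orth (X := [::]) o5.
by exists v6, v5, v4, v3.
Qed.

(** The product of the first two values is the first slot of the frame vertex, so the condition is a
    common slot up to a square. *)
Definition matching_frames (g g' : 'I_6 -> F) : Prop :=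
  exists f1 f2 f3 f4 f5 f6 h1 h2 h3 h4 h5 h6 r,
    [/\ orth g [:: f1; f2; f3; f4; f5; f6], orth g' [:: h1; h2; h3; h4; h5; h6],
      r != 0 & qf g f1 * qf g f2 = r ^+ 2 * (qf g' h1 * qf g' h2)].

Lemma matching_dependent (g g' : 'I_6 -> F) x y z :
  (forall v, qf g v = 0 -> v = 0) -> (forall v, qf g' v = 0 -> v = 0) ->
  (forall i, adj3 x y z (g i)) -> (forall i, adj3 x y z (g' i)) ->
  matching_frames g g'.
Proof.
move=> an an' gK gK'; have [s0 [s1 [t0 [t1 [os ot e0 e1]]]]] := common_pair an an' gK gK'.
have [s3 [s4 [s5 [s6 os']]]] := complete2 os.
have [t3 [t4 [t5 [t6 ot']]]] := complete2 ot.
exists s0, s1, s3, s4, s5, s6, t0, t1, t3, t4, t5, t6, 1; split.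
- by orth_reorder os'.
- by orth_reorder ot'.
- exact: oner_neq0.
- by rewrite e0 e1 expr1n mul1r.
Qed.

Variable tau : K2mod2 F.
Hypothesis ntau : ~ is_symbol2 tau.

Lemma frame_vertexE (g : 'I_6 -> F) v1 v2 v3 v4 v5 v6 :
  frame_vertex g v1 v2 v3 v4 v5 v6 =
  (sy (qf g v1 * qf g v2) (qf g v1 * qf g v3), sy (qf g v4 * qf g v5) (qf g v4 * qf g v6)).
Proof. by []. Qed.

(** Starting from the standard frame, [frames_connected] ends with an edge to the given frame, and
    both ends of an edge are vertices. *)
Lemma all_frames_vertex a b c d f1 f2 f3 f4 f5 f6 :
  a != 0 -> b != 0 -> c != 0 -> d != 0 ->
  is_vertex tau (sy a b, sy c d) -> orth (albert_coef a b c d) [:: f1; f2; f3; f4; f5; f6] ->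
  is_vertex tau (frame_vertex (albert_coef a b c d) f1 f2 f3 f4 f5 f6).
Proof.
move=> a0 b0 c0 d0 vS o.
have [h1 [h2 [h3 [h4 [h5 [h6 [oh hE]]]]]]] := albert_frame F2 a0 b0 c0 d0.
have an := albert_aniso (vertex_not_isotropic F2 ntau a0 b0 c0 d0 vS).
rewrite -hE in vS.
by have [_ [_ [_ [_ [_ ? _] _ _ _]]]] := frames_connected F2 an (albert_det a b c d) oh o vS.
Qed.

(* With [a'] a common slot up to the square z^2, the derivation dual to the other
   slot e of the frame vertex, together with the one dual to [a'], force z = 0. *)
Lemma matching_free a b c d a' b' c' d' :
  [/\ a != 0, b != 0, c != 0 & d != 0] -> [/\ a' != 0, b' != 0, c' != 0 & d' != 0] ->
  is_vertex tau (sy a b, sy c d) -> is_vertex tau (sy a' b', sy c' d') ->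
  free squares [:: a'; b'; c'; d'] ->
  matching_frames (albert_coef a b c d) (albert_coef a' b' c' d').
Proof.
move=> n n' vS vT fT; have [a0 b0 c0 d0] := n; have [a0' b0' c0' d0'] := n'.
have sq := square_subring_squares F2.
have niso := vertex_not_isotropic F2 ntau a0 b0 c0 d0 vS.
set g := albert_coef a b c d; have aniso := albert_aniso niso; rewrite -/g in aniso.
have eST : sy a b + sy c d = sy a' b' + sy c' d' by case: vS vT => _ _ /= -> [_ _ /= ->].
have [s [t [s0 t0 st]]] := slot_scaling F2 n n' niso eST; rewrite -/g in st.
have q0 := qf_neq0 aniso t0.
(* Orthogonalizing s against t produces a frame with the slot a' + z^2 up to squares, instead of
   a'. *)
pose z := bil g s t / qf g t; pose t' := s + (- z) *: t.
have tt' : bil g t t' = 0.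
  by rewrite bilC bilDl bilZl -/(qf g t) mulNr divfK // subrr.
have sE : s = 1 *: t' + z *: t by rewrite scale1r /t' scaleNr addrNK.
have qs : qf g s = qf g t' + z ^+ 2 * qf g t.
  by rewrite {1}sE qf_lin ?expr1n ?mul1r // bilC.
have qt'E : qf g t' = (a' + z ^+ 2) * qf g t.
  by rewrite mulrDl -st qs -addrA addFF // addr0.
have t'0 : t' != 0.
  apply/eqP => h; move: qt'E; rewrite h {1}/qf bil0l => /esym/eqP.
  rewrite mulf_eq0 (negbTE q0) orbF => /eqP/(addF_eq0 F2) az.
  by case: fT => + _; apply; exists z.
have ott' : orth g [:: t; t'] by rewrite !orth_cons t0 t'0 perp_cons tt' eqxx.
have [r3 [r4 [r5 [r6 or]]]] := complete2 ott'.
have o : orth g [:: t; t'; r3; r4; r5; r6] by orth_reorder or.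
have vf := all_frames_vertex a0 b0 c0 d0 vS o.
have nz v : v \in [:: t; t'; r3; r4; r5; r6] -> qf g v != 0.
  by move=> vL; exact/(qf_neq0 aniso)/(orth_neq0 aniso o).
rewrite -/g frame_vertexE in vf.
set n1 := qf g t * qf g t' in vf; set e := qf g t * qf g r3 in vf.
set G := qf g r4 * qf g r5 in vf; set H := qf g r4 * qf g r6 in vf.
have n10 : n1 != 0 by rewrite mulf_neq0 // nz // !inE eqxx ?orbT.
have e0 : e != 0 by rewrite mulf_neq0 // nz // !inE eqxx ?orbT.
have G0 : G != 0 by rewrite mulf_neq0 // nz // !inE eqxx ?orbT.
have H0 : H != 0 by rewrite mulf_neq0 // nz // !inE eqxx ?orbT.
have e2 : sy n1 e + sy G H = sy a' b' + sy c' d' by case: vf vT => _ _ /= -> [_ _ /= ->].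
have nisof := vertex_not_isotropic F2 ntau n10 e0 G0 H0 vf.
(* If these slots were dependent, some F^2(x, y, w) would contain them, hence also the four
   independent slots a', b', c', d'. *)
have fS : free squares [:: n1; e; G; H].
  apply: contrapT => nf.
  have [x [y [w [kn ke kG kH]]]] := not_free4 F2 (sy_free F2 (vertex_neq0 ntau vf).1) nf.
  have [ka kb kc kd] := slots_in_field F2 (adj3_square_subring F2 x y w)
    (And4 n10 e0 G0 H0) n' nisof e2 kn ke kG kH.
  by case: (not_free4_adj3 F2 fT a0' b0' c0' d0' ka kb kc kd).
have [D [dD tD Dk De zD]] := free_dual F2 sq (free_swap F2 sq fS).
have [D1 [d1 _ D1k D1a zD1]] := free_dual F2 sq fT.
have n1E : n1 = (a' + z ^+ 2) * qf g t ^+ 2 by rewrite /n1 qt'E; ring.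
have Dn : D n1 = 0 by apply: zD; rewrite !inE eqxx.
have DG : D G = 0 by apply: zD; rewrite !inE eqxx ?orbT.
have DH : D H = 0 by apply: zD; rewrite !inE eqxx ?orbT.
have D1b : D1 b' = 0 by apply: zD1; rewrite !inE eqxx ?orbT.
have D1c : D1 c' = 0 by apply: zD1; rewrite !inE eqxx ?orbT.
have D1d : D1 d' = 0 by apply: zD1; rewrite !inE eqxx ?orbT.
have a'E : a' = n1 * (qf g t)^-1 ^+ 2 + z ^+ 2.
  by rewrite n1E exprVn mulfK ?expf_neq0 // -addrA addFF // addr0.
have Da : D a' = 0 by rewrite a'E (derD dD) (der_sqr F2 dD z) (derM dD n1) Dn (der_sqr F2 dD (qf g t)^-1); ring.
have D1n : D1 n1 = a' * qf g t ^+ 2.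
  by rewrite n1E (derM d1 (a' + _)) (derD d1) (der_sqr F2 d1 z) (der_sqr F2 d1 (qf g t)) D1a; ring.
have := wedge_sy_eq2 F2 dD d1 n10 e0 G0 H0 a0' b0' c0' d0' e2.
rewrite /wedge (dlog0 Dn) (dlog1 e0 De) (dlog0 DG) (dlog0 DH) (dlog0 Da) (dlog1 a0' D1a).
rewrite (dlog0 D1b) (dlog0 D1c) (dlog0 D1d) !(mul0r, mulr0, add0r, addr0, mulr1, mul1r) => h.
pose rr := a' * qf g t ^+ 2 / n1.
have Db : D b' = rr * b'.
  by rewrite -[D b'](divfK b0') -/(dlog D b') -h /dlog D1n.
have Dr : D rr = 0.
  by rewrite /rr (derM dD (a' * _)) (derM dD a') Da (der_sqr F2 dD (qf g t)) (derV F2 dD n1) Dn; ring.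
(* rr is a' / (a' + z^2) and D kills it, so D^2 = D gives rr^2 = rr, hence rr = 1. *)
have := tD b'; rewrite Db (derM dD) Dr mul0r add0r Db mulrA => /(mulIf b0') rr1.
have rr0 : rr != 0 by rewrite !mulf_neq0 ?invr_eq0 ?expf_neq0.
have {}rr1 : rr = 1 by apply: (mulfI rr0); rewrite rr1 mulr1.
have n1a : n1 = a' * qf g t ^+ 2 by rewrite -[LHS]mul1r -rr1 divfK.
exists t, t', r3, r4, r5, r6.
(* The basis vectors of values b' and a' b' come first: their product is a' up to the square
   b'^2. *)
exists (row6 0 1 0 0 0 0), (row6 0 0 1 0 0 0), (row6 1 0 0 0 0 0),
  (row6 0 0 0 1 0 0), (row6 0 0 0 0 1 0), (row6 0 0 0 0 0 1), (qf g t / b'); split=> //.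
- rewrite !orth_cons !perp_cons !bil_albert_row6 !row6_eq0 !eqxx oner_eq0 /=.
  by rewrite !(mulr0, mul0r, addr0) !eqxx.
- by rewrite mulf_neq0 ?invr_eq0.
- have -> : qf (albert_coef a' b' c' d') (row6 0 1 0 0 0 0) = b'.
    by rewrite /qf bil_albert_row6; ring.
  have -> : qf (albert_coef a' b' c' d') (row6 0 0 1 0 0 0) = a' * b'.
    by rewrite /qf bil_albert_row6; ring.
  by rewrite -/n1 n1a; field.
Qed.

(** The matching frames give vertices that are equal or adjacent, and [frames_connected] for the
    second form leads on to the target; every edge on the way keeps the vertex in frames of the
    first form. *)
Lemma matching_in_frames a b c d a' b' c' d' :
  [/\ a != 0, b != 0, c != 0 & d != 0] -> [/\ a' != 0, b' != 0, c' != 0 & d' != 0] ->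
  is_vertex tau (sy a b, sy c d) -> is_vertex tau (sy a' b', sy c' d') ->
  matching_frames (albert_coef a b c d) (albert_coef a' b' c' d') ->
  in_frames (albert_coef a b c d) (sy a' b', sy c' d').
Proof.
move=> [a0 b0 c0 d0] [a0' b0' c0' d0'] vS vT.
move=> [f1 [f2 [f3 [f4 [f5 [f6 [h1 [h2 [h3 [h4 [h5 [h6 [r [o oh r0 e]]]]]]]]]]]]]].
have an := albert_aniso (vertex_not_isotropic F2 ntau a0 b0 c0 d0 vS).
have an' := albert_aniso (vertex_not_isotropic F2 ntau a0' b0' c0' d0' vT).
have vf := all_frames_vertex a0 b0 c0 d0 vS o.
have vh := all_frames_vertex a0' b0' c0' d0' vT oh.
have edge_cl := edge_in_frames F2 an (albert_det a b c d) ntau.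
have fS : in_frames (albert_coef a b c d) (frame_vertex (albert_coef a b c d) f1 f2 f3 f4 f5 f6).
  by exists f1, f2, f3, f4, f5, f6.
have fT : in_frames (albert_coef a b c d) (frame_vertex (albert_coef a' b' c' d') h1 h2 h3 h4 h5 h6).
  have nz v : v \in [:: f1; f2; f3; f4; f5; f6] -> qf (albert_coef a b c d) v != 0.
    by move=> vL; exact/(qf_neq0 an)/(orth_neq0 an o).
  have nz' v : v \in [:: h1; h2; h3; h4; h5; h6] -> qf (albert_coef a' b' c' d') v != 0.
    by move=> vL; exact/(qf_neq0 an')/(orth_neq0 an' oh).
  move: vf vh (edge_cl) fS; rewrite !frame_vertexE e sy_sqrMl // => vf vh cl fS.
  have n u v : u \in [:: f1; f2; f3; f4; f5; f6] -> v \in [:: f1; f2; f3; f4; f5; f6] ->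
      qf (albert_coef a b c d) u * qf (albert_coef a b c d) v != 0.
    by move=> /nz x0 /nz y0; rewrite mulf_neq0.
  have n' u v : u \in [:: h1; h2; h3; h4; h5; h6] -> v \in [:: h1; h2; h3; h4; h5; h6] ->
      qf (albert_coef a' b' c' d') u * qf (albert_coef a' b' c' d') v != 0.
    by move=> /nz' x0 /nz' y0; rewrite mulf_neq0.
  have := common_slot_edge F2 ntau (n' h1 h2 _ _) (n f1 f3 _ _) (n f4 f5 _ _) (n f4 f6 _ _)
    (n' h1 h3 _ _) (n' h4 h5 _ _) (n' h4 h6 _ _) vf vh.
  case; rewrite ?inE ?eqxx ?orbT //; first by move=> <-.
  by move=> [t et]; exact: cl fS et.
have [k1 [k2 [k3 [k4 [k5 [k6 [ok kE]]]]]]] := albert_frame F2 a0' b0' c0' d0'.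
have [U [W [Z [E1 E2 UW _ _]]]] := frames_connected F2 an' (albert_det a' b' c' d') oh ok vh.
have fU := edge_cl _ _ _ fT E1; rewrite -kE; apply: (edge_cl _ _ _ _ E2).
by case: UW => [-> //|[t]]; exact: edge_cl.
Qed.

(** If the target slots are dependent, they lie in some F^2(x, y, z), which by [slots_in_field] also
    contains the slots of the source; otherwise [matching_free] applies. *)
Lemma vertex_in_frames a b c d a' b' c' d' :
  [/\ a != 0, b != 0, c != 0 & d != 0] -> [/\ a' != 0, b' != 0, c' != 0 & d' != 0] ->
  is_vertex tau (sy a b, sy c d) -> is_vertex tau (sy a' b', sy c' d') ->
  in_frames (albert_coef a b c d) (sy a' b', sy c' d').
Proof.
move=> n n' vS vT; apply: matching_in_frames => //.
have [a0 b0 c0 d0] := n; have [a0' b0' c0' d0'] := n'.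
have [fT|nT] := pselect (free squares [:: a'; b'; c'; d']); first exact: matching_free.
have niso := vertex_not_isotropic F2 ntau a0 b0 c0 d0 vS.
have niso' := vertex_not_isotropic F2 ntau a0' b0' c0' d0' vT.
have e : sy a' b' + sy c' d' = sy a b + sy c d by case: vS vT => _ _ /= -> [_ _ /= ->].
have [x [y [z [ka' kb' kc' kd']]]] := not_free4 F2 (sy_free F2 (vertex_neq0 ntau vT).1) nT.
have sq := adj3_square_subring F2 x y z.
have [ka kb kc kd] := slots_in_field F2 sq n' n niso' e ka' kb' kc' kd'.
apply: (matching_dependent (albert_aniso niso) (albert_aniso niso')).
- exact: (albert_coef_in sq ka kb kc kd).
- exact: (albert_coef_in sq ka' kb' kc' kd').
Qed.

Lemma vertices_connected v w : is_vertex tau v -> is_vertex tau w ->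
  exists U W Z : K2mod2 F * K2mod2 F,
   [/\ edge tau typeI v U, edge tau typeI W w, W = U \/ exists t, edge tau t U W,
       edge tau typeI U Z & edge tau typeI Z W].
Proof.
move=> vv vw.
have [a [b [c [d [n vE]]]]] := vertex_sy vv; have [a' [b' [c' [d' [n' wE]]]]] := vertex_sy vw.
rewrite vE wE in vv vw *; have [a0 b0 c0 d0] := n.
have [f1 [f2 [f3 [f4 [f5 [f6 [o ->]]]]]]] := vertex_in_frames n n' vv vw.
have [k1 [k2 [k3 [k4 [k5 [k6 [ok kE]]]]]]] := albert_frame F2 a0 b0 c0 d0.
have an := albert_aniso (vertex_not_isotropic F2 ntau a0 b0 c0 d0 vv).
rewrite -kE; apply: (frames_connected F2 an (albert_det a b c d) ok o).
by rewrite kE.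
Qed.

End Matching.

(** * The case where tau is a symbol, and the theorem *)

Section SymbolCase.
Variable F : fieldType.
Hypothesis F2 : 2%:R = 0 :> F.
Variable tau : K2mod2 F.

(* ({p,q}, {p,r}) is joined to ({p,qr}, 0) by the edge with [e = p r]. *)
Lemma edge_to_symbol v : is_symbol2 tau -> is_vertex tau v -> edge tau typeI v (tau, 0).
Proof.
move=> [x [y tauE]] vv; have [a [b [c [d [[a0 b0 c0 d0] vE]]]]] := vertex_sy vv.
rewrite vE in vv *; have [_ _ /= e] := vv.
have [x0 y0] : val x != 0 /\ val y != 0 by split; [exact: (valP x)|exact: (valP y)].
have e' : sy a b + sy c d = sy (val x) (val y) by rewrite e tauE symbol2_sy.
have [p [q [r [p0 q0 r0 e1 e2]]]] := albert_isotropic_linked F2 a0 b0 c0 d0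
  (sum_symbol_isotropic F2 a0 b0 c0 d0 x0 y0 e').
have e2' : sy c d = sy r p by rewrite e2 syC.
have pr0 : 0 ^+ 2 + p * r != 0 by rewrite expr0n add0r mulf_neq0.
have E1 : sy p (p * r * q) = tau.
  by rewrite !syMr ?mulf_neq0 // (sy_aa F2 p) add0r addrC -e1 -e2.
have E2 : sy r (p * r * p) = 0.
  by rewrite !syMr ?mulf_neq0 // (sy_aa F2 r) addr0 K2mod2_addxx.
have := edge_step F2 (x := 0) p0 q0 r0 p0 pr0; rewrite -e1 -e2' eqxx => /(_ _ vv).
by rewrite expr0n add0r E1 E2.
Qed.

Lemma symbol_connected v w : is_symbol2 tau -> is_vertex tau v -> is_vertex tau w ->
  path_in_graph tau v [:: typeI; typeI] w.
Proof.
move=> stau vv vw; apply: path_cons (edge_to_symbol stau vv) _.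
by apply: path_cons (edge_sym (edge_to_symbol stau vw)) _; exact: path_nil.
Qed.

End SymbolCase.

Theorem theorem3p2 (F : fieldType) (char2 : 2%N \in [pchar F])
    (tau : K2mod2 F)
    (tau_sum : exists S1 S2 : K2mod2 F,
        [/\ is_symbol2 S1, is_symbol2 S2 & tau = S1 + S2]) :
  forall v w : K2mod2 F * K2mod2 F, is_vertex tau v -> is_vertex tau w ->
  [/\ exists s : seq edge_type,
        [/\ path_in_graph tau v s w,
            (size s <= 3)%N & (count is_typeII s <= 1)%N],
      (forall s : seq edge_type,
         path_in_graph tau v s w ->
         (size s <= 3)%N -> (count is_typeII s <= 1)%N ->
         size s = 3%N /\ has is_typeII s) ->
      path_in_graph tau v [:: typeI; typeII; typeI] w
    & exists s : seq edge_type,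
        [/\ path_in_graph tau v s w,
            (size s <= 4)%N & ~~ has is_typeII s]].
Proof.
have F2 : 2%:R = 0 :> F by case/andP: char2 => _ /eqP.
move=> v w vv vw; have [stau|ntau] := pselect (is_symbol2 tau).
  have p := symbol_connected F2 stau vv vw.
  split; [by exists [:: typeI; typeI]| |by exists [:: typeI; typeI]].
  by move=> /(_ _ p isT isT)[].
have [U [W [Z [E1 E2 UW E3 E4]]]] := vertices_connected F2 ntau vv vw.
have end_path : path_in_graph tau w [::] w by exact: path_nil.
split.
- case: UW => [eUW|[t Et]].
  + exists [:: typeI; typeI]; split=> //.
    by apply: path_cons E1 _; rewrite -eUW; exact: path_cons E2 _.
  + exists [:: typeI; t; typeI]; split=> //; last by case: (t).
    by apply: path_cons E1 _; apply: path_cons Et _; exact: path_cons E2 _.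
(* A path with two edges, or with three of type I, contradicts [only3], so the middle edge has type
   II. *)
- move=> only3; case: UW => [eUW|[[] Et]].
  + have p : path_in_graph tau v [:: typeI; typeI] w.
      by apply: path_cons E1 _; rewrite -eUW; exact: path_cons E2 _.
    by have [] := only3 _ p isT isT.
  + have p : path_in_graph tau v [:: typeI; typeI; typeI] w.
      by apply: path_cons E1 _; apply: path_cons Et _; exact: path_cons E2 _.
    by have [] := only3 _ p isT isT.
  + by apply: path_cons E1 _; apply: path_cons Et _; exact: path_cons E2 _.
- exists [:: typeI; typeI; typeI; typeI]; split=> //.
  apply: path_cons E1 _; apply: path_cons E3 _; apply: path_cons E4 _.
  exact: path_cons E2 _.
Qed.
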